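(* Let $n\ge 2$ and $r\ge 1$ be integers and let $S\subseteq \mathfrak{C}_{n,r}$ be a finite set of rational points. Then $$\mathrm{Fix}(S)\big/[\mathrm{Fix}(S),\mathrm{Fix}(S)] \cong \begin{cases}\mathbb{Z}^{|S|} & \text{if $n$ is even,} \\ \mathbb{Z}^{|S|}\oplus \mathbb{Z}_2 & \text{if $n$ is odd.}\end{cases}$$
   Context: For integers $n\ge 2$, $r\ge 1$, let $\mathfrak{C}_{n,r}=\{1,\ldots,r\}\times\{1,\ldots,n\}^\omega$ be the Cantor space (product topology) of infinite sequences whose first digit lies in $\{1,\ldots,r\}$ and whose remaining digits lie in $\{1,\ldots,n\}$. For a finite prefix $\alpha\in\{1,\ldots,r\}\times\{1,\ldots,n\}^*$, the cone $C_\alpha$ is the set of all sequences in $\mathfrak{C}_{n,r}$ having $\alpha$ as a prefix. Given cones $C_\alpha$ and $C_\beta$, the prefix-replacement homeomorphism $C_\alpha\to C_\beta$ is $\alpha\psi\mapsto\beta\psi$. A homeomorphism of $\mathfrak{C}_{n,r}$ is Thompson-like if each point of $\mathfrak{C}_{n,r}$ is contained in a cone on which it restricts to a prefix replacement. The Higman--Thompson group $V_{n,r}$ is the group of all Thompson-like homeomorphisms of $\mathfrak{C}_{n,r}$. A point of $\mathfrak{C}_{n,r}$ is rational if its sequence is eventually repeating (eventually periodic). $\mathrm{Fix}(S)$ is the subgroup of $V_{n,r}$ of elements that fix $S$ pointwise. $\mathbb{Z}_2$ is the cyclic group of order two. *)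

(* Defs.v *)
From HB Require Import structures.
From mathcomp Require Import all_boot all_order all_algebra finmap.
From mathcomp Require Import boolp classical_sets topology.

Set Implicit Arguments.
Unset Strict Implicit.
Unset Printing Implicit Defensive.

Local Open Scope classical_set_scope.
Local Open Scope group_scope.

Definition isomorphic_groups (G H : groupType) : Prop :=
  exists f : {multiplicative G -> H}, bijective f.

Section Abelianization.
Variable G : groupType.

Definition commutator_subgroup : set G :=
  smallest (fun H : set G => group_closed (mem H))
           [set [~ x, y] | x in setT & y in setT].

Lemma commutator_subgroup_closed : group_closed (mem commutator_subgroup).
Proof.
split=> [|x y /set_mem Dx /set_mem Dy]; apply/mem_set => H [HG HR].
  exact/set_mem/HG.1.
by apply/set_mem/HG.2; apply/mem_set; [apply: Dx | apply: Dy].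
Qed.

Lemma commutator_subgroup1 : commutator_subgroup 1.
Proof. exact/set_mem/commutator_subgroup_closed.1. Qed.

Lemma commutator_subgroupF x y :
  commutator_subgroup x -> commutator_subgroup y -> commutator_subgroup (x / y).
Proof.
by move=> Dx Dy; apply/set_mem/commutator_subgroup_closed.2; apply/mem_set.
Qed.

Lemma commutator_subgroupV x :
  commutator_subgroup x -> commutator_subgroup x^-1.
Proof.
by move=> Dx; rewrite -[x^-1]mul1g; apply: commutator_subgroupF => //;
  exact: commutator_subgroup1.
Qed.

Lemma commutator_subgroupM x y :
  commutator_subgroup x -> commutator_subgroup y -> commutator_subgroup (x * y).
Proof.
by move=> Dx Dy; rewrite -[y]invgK; apply: commutator_subgroupF => //;
  exact: commutator_subgroupV.
Qed.

Lemma commutator_subgroupR x y : commutator_subgroup [~ x, y].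
Proof. by apply: sub_gen_smallest; exists x => //; exists y. Qed.

Lemma commutator_subgroupJ x y :
  commutator_subgroup x -> commutator_subgroup (x ^ y).
Proof.
move=> Dx; rewrite -[x ^ y](mulVKg x).
by apply: commutator_subgroupM => //; exact: commutator_subgroupR.
Qed.

Definition coset_rel (x y : G) : bool := `[< commutator_subgroup (x^-1 * y) >].

Lemma coset_rel_refl : reflexive coset_rel.
Proof.
by move=> x; apply/asboolP; rewrite mulVg; exact: commutator_subgroup1.
Qed.

Lemma coset_rel_sym : symmetric coset_rel.
Proof.
by move=> x y; apply/asboolP/asboolP => /commutator_subgroupV;
  rewrite invgM invgK.
Qed.

Lemma coset_rel_trans : transitive coset_rel.
Proof.
move=> y x z /asboolP xy /asboolP yz; apply/asboolP.
by have := commutator_subgroupM xy yz; rewrite -mulgA mulVKg.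
Qed.

Canonical coset_equiv :=
  EquivRel coset_rel coset_rel_refl coset_rel_sym coset_rel_trans.

Definition abelianization : Type := {eq_quot coset_equiv}%qT.

HB.instance Definition _ := Choice.on abelianization.
HB.instance Definition _ := EqQuotient.on abelianization.

Local Open Scope quotient_scope.

Definition ab_proj (x : G) : abelianization := \pi_abelianization x.
Definition ab_mul (u v : abelianization) := ab_proj (repr u * repr v).
Definition ab_inv (u : abelianization) := ab_proj (repr u)^-1.

Lemma ab_projP x y :
  ab_proj x = ab_proj y <-> commutator_subgroup (x^-1 * y).
Proof.
rewrite /ab_proj; split=> [/eqmodP/asboolP //|Dxy].
by apply/eqmodP/asboolP.
Qed.

Lemma ab_projK u : ab_proj (repr u) = u.
Proof. exact: reprK. Qed.

Lemma ab_repr x : commutator_subgroup ((repr (ab_proj x))^-1 * x).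
Proof. by apply/ab_projP; rewrite ab_projK. Qed.

Lemma ab_projM x y : ab_proj (x * y) = ab_mul (ab_proj x) (ab_proj y).
Proof.
apply/esym/ab_projP; set x' := repr _; set y' := repr _.
have -> : (x' * y')^-1 * (x * y) = (x'^-1 * x) ^ y' * (y'^-1 * y).
  by rewrite /conjg invgM -!mulgA mulVKg.
by apply: commutator_subgroupM; [apply: commutator_subgroupJ|]; apply: ab_repr.
Qed.

Lemma ab_projV x : ab_proj x^-1 = ab_inv (ab_proj x).
Proof.
apply/esym/ab_projP; set x' := repr _.
have -> : x'^-1^-1 * x^-1 = ((x'^-1 * x)^-1) ^ x'^-1.
  by rewrite /conjg invgM !invgK -mulgA mulgV mulg1.
by apply: commutator_subgroupJ; apply: commutator_subgroupV; apply: ab_repr.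
Qed.

Lemma ab_mulA : associative ab_mul.
Proof.
move=> u v w; rewrite -[u]ab_projK -[v]ab_projK -[w]ab_projK.
by rewrite -!ab_projM mulgA.
Qed.

Lemma ab_mul1 : left_id (ab_proj 1) ab_mul.
Proof. by move=> u; rewrite -[u]ab_projK -ab_projM mul1g. Qed.

Lemma ab_mulr1 : right_id (ab_proj 1) ab_mul.
Proof. by move=> u; rewrite -[u]ab_projK -ab_projM mulg1. Qed.

Lemma ab_mulV : left_inverse (ab_proj 1) ab_inv ab_mul.
Proof. by move=> u; rewrite -[u]ab_projK -ab_projV -ab_projM mulVg. Qed.

Lemma ab_mulrV : right_inverse (ab_proj 1) ab_inv ab_mul.
Proof. by move=> u; rewrite -[u]ab_projK -ab_projV -ab_projM mulgV. Qed.

HB.instance Definition _ := isGroup.Build abelianization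
  ab_mulA ab_mul1 ab_mulr1 ab_mulV ab_mulrV.

End Abelianization.

Section Homeomorphisms.
Variable X : topologicalType.

Record homeo := Homeo {
  homeo_fun :> X -> X;
  homeo_inv : X -> X;
  homeo_funK : cancel homeo_fun homeo_inv;
  homeo_invK : cancel homeo_inv homeo_fun;
  homeo_fun_continuous : continuous homeo_fun;
  homeo_inv_continuous : continuous homeo_inv }.

HB.instance Definition _ := gen_eqMixin homeo.
HB.instance Definition _ := gen_choiceMixin homeo.

Lemma homeo_eq (f g : homeo) : f =1 g -> f = g.
Proof.
case: f g => [f f' fK f'K cf cf'] [g g' gK g'K cg cg'] /= /funext fg.
move: fK f'K cf; rewrite {f}fg => fK f'K cf.
have E : f' = g' by apply/funext => x; rewrite -{1}[x]g'K fK.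
case: _ / E in gK g'K cg' *.
by congr Homeo; exact: Prop_irrelevance.
Qed.

Definition homeo1 : homeo :=
  @Homeo id id (fun=> erefl) (fun=> erefl) (fun _ => cvg_id) (fun _ => cvg_id).

Definition homeoV (f : homeo) : homeo :=
  Homeo (homeo_invK f) (homeo_funK f)
        (@homeo_inv_continuous f) (@homeo_fun_continuous f).

Definition homeoM (f g : homeo) : homeo :=
  @Homeo (f \o g) (homeo_inv g \o homeo_inv f)
    (can_comp (homeo_funK f) (homeo_funK g))
    (can_comp (homeo_invK g) (homeo_invK f))
    (fun x => continuous_comp (@homeo_fun_continuous g x)
                              (@homeo_fun_continuous f (g x)))
    (fun x => continuous_comp (@homeo_inv_continuous f x)
                              (@homeo_inv_continuous g (homeo_inv f x))).

Lemma homeoMA : associative homeoM.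
Proof. by move=> f g h; exact: homeo_eq. Qed.

Lemma homeoM1 : left_id homeo1 homeoM.
Proof. by move=> f; exact: homeo_eq. Qed.

Lemma homeoMr1 : right_id homeo1 homeoM.
Proof. by move=> f; exact: homeo_eq. Qed.

Lemma homeoMV : left_inverse homeo1 homeoV homeoM.
Proof. by move=> f; apply: homeo_eq => x; exact: homeo_funK. Qed.

Lemma homeoMrV : right_inverse homeo1 homeoV homeoM.
Proof. by move=> f; apply: homeo_eq => x; exact: homeo_invK. Qed.

HB.instance Definition _ := isGroup.Build homeo
  homeoMA homeoM1 homeoMr1 homeoMV homeoMrV.

End Homeomorphisms.

(* The digits 1, ..., r and 1, ..., n are numbered from 0 here. *)
Definition cantor (n r : nat) : Type :=
  (discrete_topology 'I_r *
   prod_topology (fun _ : nat => discrete_topology 'I_n))%type.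

HB.instance Definition _ n r := Topological.on (cantor n r).

Section HigmanThompson.
Variables n r : nat.

Definition prefix_word : Type := ('I_r * seq 'I_n)%type.

(* Concatenation: position i is past the end of a.2 exactly when nth returns
   its default value. *)
Definition prefix_cat (a : prefix_word) (psi : nat -> 'I_n) : cantor n r :=
  (a.1, fun i => nth (psi (i - size a.2)%N) a.2 i).

Definition cone (a : prefix_word) : set (cantor n r) := range (prefix_cat a).

Definition is_prefix_replacement (f : cantor n r -> cantor n r)
    (a b : prefix_word) : Prop :=
  forall psi, f (prefix_cat a psi) = prefix_cat b psi.

Definition thompson_like : set (homeo (cantor n r)) :=
  [set f | forall x, exists a b, cone a x /\ is_prefix_replacement f a b].

Definition prefix_ext (a : prefix_word) (s : seq 'I_n) : prefix_word :=
  (a.1, a.2 ++ s).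

Lemma prefix_cat_ext a s psi :
  prefix_cat (prefix_ext a s) psi = prefix_cat a (prefix_cat (a.1, s) psi).2.
Proof.
congr pair; apply/funext => i /=; rewrite nth_cat size_cat subnDA.
case: ltnP => ia; first exact: set_nth_default.
by rewrite [RHS]nth_default.
Qed.

Lemma prefix_cat_inj a phi psi :
  prefix_cat a phi = prefix_cat a psi -> phi = psi.
Proof.
case=> /(congr1 (fun h : nat -> _ => fun i => h (size a.2 + i)%N)) E.
apply/funext => i; have := congr1 (@^~ i) E => /=.
by rewrite addKn !nth_default ?leq_addr.
Qed.

Lemma prefix_cat_comparable a b phi psi :
    prefix_cat a phi = prefix_cat b psi -> (size a.2 <= size b.2)%N ->
  exists s, b = prefix_ext a s.
Proof.
case: a b => [a u] [b v] [/= -> /(congr1 (fun h : nat -> _ => h)) E le_uv].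
exists (drop (size u) v); congr pair; rewrite /= -{1}(cat_take_drop (size u) v).
congr (_ ++ _); apply: (@eq_from_nth _ (phi 0)) => [|i].
  by rewrite size_takel.
rewrite size_takel // => iu; rewrite nth_take //.
have := congr1 (@^~ i) E => /=.
rewrite (set_nth_default (phi 0) _ iu) => ->.
by apply: set_nth_default; exact: leq_trans iu le_uv.
Qed.

Lemma thompson_likeM f g :
  thompson_like f -> thompson_like g -> thompson_like (f * g).
Proof.
move=> Tf Tg x; have [a [b [[psi _ <-] gab]]] := Tg x.
have [c [d [[phi _ E] fcd]]] := Tf (g (prefix_cat a psi)).
rewrite gab in E; have [le_cb|/ltnW le_bc] := leqP (size c.2) (size b.2).
  have [s b_def] := prefix_cat_comparable E le_cb.
  exists a, (prefix_ext d s); split=> [|w]; first by exists psi.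
  rewrite [LHS]/= gab b_def prefix_cat_ext fcd.
  by rewrite (prefix_cat_ext d).
have [s c_def] := prefix_cat_comparable (esym E) le_bc.
exists (prefix_ext a s), d; split=> [|w].
  exists phi => //; rewrite prefix_cat_ext; congr prefix_cat.
  by apply: (@prefix_cat_inj b); rewrite -E c_def prefix_cat_ext.
rewrite [LHS]/= prefix_cat_ext gab -fcd c_def; congr (f _).
by rewrite prefix_cat_ext.
Qed.

Lemma thompson_likeV f : thompson_like f -> thompson_like f^-1.
Proof.
move=> Tf x; have [a [b [[psi _ E] fab]]] := Tf (homeo_inv f x).
exists b, a; split=> [|w]; last by rewrite -fab; exact: homeo_funK.
by exists psi => //; rewrite -fab E homeo_invK.
Qed.

Lemma thompson_like1 : thompson_like 1.
Proof.
move=> x; exists (x.1, [::]), (x.1, [::]); split=> //.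
exists x.2 => //; case: x => x1 x2; congr pair; apply/funext => i /=.
by rewrite nth_nil subn0.
Qed.

Lemma thompson_like_closed :
  group_closed (fun f => `[< thompson_like f >] : bool).
Proof.
split=> [|f g /asboolP Tf /asboolP Tg]; apply/asboolP.
  exact: thompson_like1.
exact/(thompson_likeM Tf)/thompson_likeV.
Qed.

Definition higman_thompson : Type := {f | `[< thompson_like f >]}.

HB.instance Definition _ := SubChoice.on higman_thompson.
HB.instance Definition _ := SubChoice_isSubGroup.Build _ _ higman_thompson
  thompson_like_closed.

Definition fixes (S : set (cantor n r)) : set higman_thompson :=
  [set g : higman_thompson | forall x, S x -> homeo_fun (val g) x = x].

Lemma fixes_closed S : group_closed (fun g => `[< fixes S g >] : bool).
Proof.
split=> [|f g /asboolP Ff /asboolP Fg]; apply/asboolP => x Sx.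
  by rewrite val1.
rewrite valM gmulfV; rewrite -[RHS](Ff _ Sx); congr (homeo_fun (val f) _).
by rewrite -[in LHS](Fg _ Sx); exact: homeo_funK.
Qed.

Definition Fix (S : set (cantor n r)) : Type := {g | `[< fixes S g >]}.

HB.instance Definition _ S := SubChoice.on (Fix S).
HB.instance Definition _ S := SubChoice_isSubGroup.Build _ _ (Fix S)
  (fixes_closed S).

Definition rational (x : cantor n r) : Prop :=
  exists N p, (0 < p)%N /\ forall i, (N <= i)%N -> x.2 (i + p)%N = x.2 i.

End HigmanThompson.

(* Main.v *)
Require Import Defs.
From HB Require Import structures.
From mathcomp Require Import all_boot all_order all_algebra finmap.
From mathcomp Require Import boolp classical_sets topology.
From mathcomp Require Import zify.

Set Implicit Arguments.
Unset Strict Implicit.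
Unset Printing Implicit Defensive.

(** Fix [x] in [S]. An element of [Fix(S)] replaces, near [x], a prefix [a] of [x]
    by a prefix [b] of [x], and the difference of the lengths of [b] and [a] is a
    homomorphism to Z. The tail of [x] is then invariant under a shift by this
    difference, so that the values are multiples of the eventual period of [x];
    dividing by the period gives the germ of the element at [x]. For odd [n]
    there is a further homomorphism, the sign: an element acts as a bijection
    from one partition into cones to another, and the parity of the number of
    pairs of cones whose lexicographic order it reverses does not change when a
    cone is cut into its [n] subcones, because [n] is odd. The parity is computed
    on finite sets of sample points that meet each cone of some level an odd
    number of times; such a set keeps this property, at another level, when it is
    moved by an element, whence multiplicativity ([signM]).

    These maps are jointly onto. To get germ 1 at [x] and 0 elsewhere, push a
    cone around [x] through a cone away from [S] onto the next smaller cone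
    around [x] whose prefix is one period longer ([degree_generator]). The
    exchange of two sibling cones away from [S] has trivial germs and nontrivial
    sign ([sign_sibling_swap]).

    It remains to see that an element with trivial germs, and trivial sign if [n]
    is odd, vanishes in the abelianization. An element with trivial germs is the
    identity near [S], and it is a product of exchanges of pairs of small cones
    away from [S]: as long as the images of the cones of level [N] do not all
    have level [N], some exchange makes them more balanced ([table_tau_class]),
    and a permutation of the cones of level [N] is a product of transpositions
    ([table_perm]). Two such exchanges are conjugate, since there is always room
    to move both pairs of cones onto a third one ([small_swap_eq]). Hence they
    all have the same class [tau] in the abelianization, and [tau] has order at
    most two. If [n] is odd, the sign decides between 1 and [tau]. If [n] is
    even, cutting the two cones into their subcones shows that [tau] is its own
    [n]-th power, so [tau = 1] ([tau_even]). *)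

(** * Words, cones and tails *)

Section Words.
Variables n r : nat.
Local Notation X := (cantor n r).
Local Notation word := (prefix_word n r).
Implicit Types (x y : X) (a b c d : word) (psi : nat -> 'I_n).

Definition len a := size a.2.

Definition trunc x k : word := (x.1, mkseq x.2 k).

Definition tail x k : nat -> 'I_n := fun i => x.2 (k + i).

Definition in_cone a x : bool := trunc x (len a) == a.

Definition prefix_of a b : bool := (a.1 == b.1) && prefix a.2 b.2.

Definition comparable a b : bool := prefix_of a b || prefix_of b a.

Lemma trunc_tail x k : prefix_cat (trunc x k) (tail x k) = x.
Proof.
case: x => x1 x2; congr pair; apply/funext => i /=; rewrite size_mkseq.
have [lt_ik|le_ki] := ltnP i k; first by rewrite nth_mkseq.
by rewrite nth_default ?size_mkseq // /tail subnKC.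
Qed.

Lemma len_trunc x k : len (trunc x k) = k.
Proof. exact: size_mkseq. Qed.

Lemma trunc_prefix_cat a psi k : k <= len a ->
  trunc (prefix_cat a psi) k = (a.1, take k a.2).
Proof.
move=> le_k; congr pair; apply: (@eq_from_nth _ (psi 0)) => [|i].
  by rewrite size_mkseq size_takel.
rewrite size_mkseq => lt_ik; rewrite nth_mkseq // nth_take //=.
by apply: set_nth_default; exact: leq_trans lt_ik le_k.
Qed.

Lemma prefix_catK a psi : trunc (prefix_cat a psi) (len a) = a.
Proof. by rewrite trunc_prefix_cat // take_size -surjective_pairing. Qed.

Lemma tail_prefix_cat a psi : tail (prefix_cat a psi) (len a) = psi.
Proof.
by apply/funext => i; rewrite /tail /= nth_default ?leq_addr // addKn.
Qed.

Lemma in_cone_cat a psi : in_cone a (prefix_cat a psi).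
Proof. by rewrite /in_cone prefix_catK. Qed.

Lemma in_coneE a x : in_cone a x -> x = prefix_cat a (tail x (len a)).
Proof. by move=> /eqP {1}<-; rewrite trunc_tail. Qed.

Lemma in_coneP a x : reflect (cone a x) (in_cone a x).
Proof.
apply: (iffP idP) => [/in_coneE ->|[psi _ <-]]; last exact: in_cone_cat.
by exists (tail x (len a)).
Qed.

Lemma in_cone_trunc x k : in_cone (trunc x k) x.
Proof. by rewrite /in_cone len_trunc. Qed.

Lemma prefix_ofP a b : reflect (exists s, b = prefix_ext a s) (prefix_of a b).
Proof.
case: a b => [a u] [b v]; apply: (iffP andP) => [[/eqP /= <- /prefixP[s ->]]|].
  by exists s.
by case=> s [-> ->]; split=> //=; apply: prefix_prefix.
Qed.

Lemma len_ext a s : len (prefix_ext a s) = len a + size s.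
Proof. exact: size_cat. Qed.

Lemma prefix_ext0 a : prefix_ext a [::] = a.
Proof. by rewrite /prefix_ext cats0 -surjective_pairing. Qed.

Lemma prefix_ext_cat a s t :
  prefix_ext (prefix_ext a s) t = prefix_ext a (s ++ t).
Proof. by rewrite /prefix_ext /= catA. Qed.

Lemma prefix_ofE a b : prefix_of a b -> b = prefix_ext a (drop (len a) b.2).
Proof.
by case/prefix_ofP => s ->; rewrite /prefix_ext /= drop_size_cat.
Qed.

Lemma prefix_of_refl a : prefix_of a a.
Proof. by apply/prefix_ofP; exists [::]; rewrite prefix_ext0. Qed.

Lemma prefix_of_ext a s : prefix_of a (prefix_ext a s).
Proof. by apply/prefix_ofP; exists s. Qed.

Lemma prefix_of_trans a b c : prefix_of a b -> prefix_of b c -> prefix_of a c.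
Proof.
case/prefix_ofP=> s -> /prefix_ofP[t ->]; apply/prefix_ofP; exists (s ++ t).
exact: prefix_ext_cat.
Qed.

Lemma prefix_of_len a b : prefix_of a b -> len a <= len b.
Proof. by case/prefix_ofP=> s ->; rewrite len_ext leq_addr. Qed.

Lemma prefix_of_eq a b : prefix_of a b -> len b <= len a -> a = b.
Proof.
case/prefix_ofP=> s ->; rewrite len_ext => le_s; rewrite (_ : s = [::]).
  by rewrite prefix_ext0.
by apply/nilP; rewrite /nilp; lia.
Qed.

Lemma comparable_refl a : comparable a a.
Proof. by rewrite /comparable prefix_of_refl. Qed.

Lemma comparable_sym a b : comparable a b = comparable b a.
Proof. by rewrite /comparable orbC. Qed.

Lemma comparable_le a b : comparable a b -> len a <= len b -> prefix_of a b.
Proof.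
case/orP=> // /[dup] /prefix_of_eq + _ le_ab => /(_ le_ab) ->.
exact: prefix_of_refl.
Qed.

Lemma comparable_eq a b : comparable a b -> len a = len b -> a = b.
Proof.
by move=> cab e; apply: prefix_of_eq; [apply: comparable_le; rewrite ?e|rewrite e].
Qed.

Lemma in_cone_ext a s x :
  in_cone (prefix_ext a s) x = in_cone a x && in_cone (a.1, s) (a.1, tail x (len a)).
Proof.
apply/idP/andP => [/in_coneE ->|[/in_coneE {2}-> /in_coneE E]].
  rewrite !prefix_cat_ext in_cone_cat tail_prefix_cat; split=> //.
  exact: in_cone_cat.
move/(congr1 snd): E; rewrite [LHS]/= => ->.
by rewrite -prefix_cat_ext in_cone_cat.
Qed.

Lemma prefix_of_cone a b x : prefix_of a b -> in_cone b x -> in_cone a x.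
Proof. by case/prefix_ofP=> s ->; rewrite in_cone_ext => /andP[]. Qed.

Lemma in_cone_comparable a b x : in_cone a x -> in_cone b x -> comparable a b.
Proof.
move=> /in_coneE Ea /in_coneE Eb; rewrite /comparable.
have E := etrans (esym Ea) Eb; have [le|/ltnW le] := leqP (len a) (len b).
  by have [s ->] := prefix_cat_comparable E le; rewrite prefix_of_ext.
by have [s ->] := prefix_cat_comparable (esym E) le; rewrite prefix_of_ext orbT.
Qed.

Lemma in_cone_disjoint a b x : ~~ comparable a b -> in_cone a x -> ~~ in_cone b x.
Proof. by move=> nab ax; apply: contra nab; apply: in_cone_comparable. Qed.

Lemma comparable_ext a b s t : 
  comparable (prefix_ext a s) (prefix_ext b t) -> comparable a b.
Proof.
have: forall a b s t, prefix_of (prefix_ext a s) (prefix_ext b t) -> comparable a b.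
  move=> {}a {}b {}s {}t /prefix_ofP[u].
  case: a b => [a a'] [b b'] /= [-> E].
  rewrite /comparable /prefix_of /= !eqxx /= !prefixE.
  have [le|/ltnW le] := leqP (size a') (size b'); apply/orP; [left|right].
    move/(congr1 (take (size a'))): E.
    by rewrite takel_cat // -catA take_size_cat // => ->.
  move/(congr1 (take (size b'))): E.
  by rewrite take_size_cat // -catA takel_cat // => <-.
by move=> H /orP[/H //|/H]; rewrite comparable_sym.
Qed.

Lemma trunc_ext x k l :
  trunc x (k + l) = prefix_ext (trunc x k) (mkseq (tail x k) l).
Proof.
congr pair; rewrite /mkseq iotaD map_cat add0n; congr cat.
by rewrite -[in LHS](addn0 k) iotaDl -map_comp.
Qed.

Lemma trunc_prefix x k l : k <= l -> prefix_of (trunc x k) (trunc x l).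
Proof. by move/subnKC <-; rewrite trunc_ext prefix_of_ext. Qed.

Lemma in_cone_len_eq a b x :
  in_cone a x -> in_cone b x -> len a = len b -> a = b.
Proof. by move=> /eqP <- /eqP <-; rewrite !len_trunc => ->. Qed.

End Words.

(** * Local prefix replacements *)

Section Replacements.
Variables n r : nat.
Local Notation X := (cantor n r).
Local Notation word := (prefix_word n r).
Local Notation repl := (@is_prefix_replacement n r).
Implicit Types (x y : X) (a b c d : word) (F G : X -> X).

Definition locally_repl F := forall x, exists a b, cone a x /\ repl F a b.

Lemma repl_ext F a b s : repl F a b -> repl F (prefix_ext a s) (prefix_ext b s).
Proof. by move=> Fab psi; rewrite !prefix_cat_ext Fab. Qed.

Lemma repl_comp F G a b c : repl G a b -> repl F b c -> repl (F \o G) a c.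
Proof. by move=> Gab Fbc psi; rewrite /= Gab Fbc. Qed.

Lemma repl_cone F a b x : repl F a b -> in_cone a x -> in_cone b (F x).
Proof. by move=> Fab /in_coneE ->; rewrite Fab in_cone_cat. Qed.

Lemma repl_trunc F a b x k :
    repl F a b -> in_cone a x -> len a <= k ->
  exists2 c, repl F (trunc x k) c & len c + len a = len b + k.
Proof.
move=> Fab /eqP ax /subnKC <-; rewrite trunc_ext ax.
exists (prefix_ext b (mkseq (tail x (len a)) (k - len a))); first exact: repl_ext.
by rewrite len_ext size_mkseq addnAC addnA.
Qed.

Lemma locally_repl_deep F x k : locally_repl F ->
  exists l b, [/\ k <= l, k <= len b & repl F (trunc x l) b].
Proof.
move=> /(_ x)[a [b [/in_coneP ax Fab]]].
have [|c Fc e] := @repl_trunc F a b x (k + len a + len a) Fab ax; first lia.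
exists (k + len a + len a), c; split=> //; first lia.
by move: e; lia.
Qed.

Lemma locally_repl_comp F G :
  locally_repl F -> locally_repl G -> locally_repl (F \o G).
Proof.
move=> LF LG x; have [a [b [/in_coneP aGx Fab]]] := LF (G x).
have [l [c [_ ac Gc]]] := @locally_repl_deep G x (len a) LG.
have cGx := repl_cone Gc (in_cone_trunc x l).
have /prefix_ofP[s Ec] : prefix_of a c.
  by apply: comparable_le => //; apply: in_cone_comparable aGx cGx.
exists (trunc x l), (prefix_ext b s); split; first exact/in_coneP/in_cone_trunc.
by apply: repl_comp Gc _; rewrite Ec; apply: repl_ext.
Qed.

Local Open Scope classical_set_scope.

Lemma near_digit x i : nbhs x [set y : X | y.2 i = x.2 i].
Proof.
have := @proj_continuous nat (fun=> discrete_topology 'I_n) i x.2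
  [set (x.2 i)] (discrete_set1 _).
exact: (@cvg_snd _ _ (nbhs x.1) (nbhs x.2) _ [set z | z i = x.2 i]).
Qed.

Lemma near_trunc x k : nbhs x [set y | trunc y k = trunc x k].
Proof.
elim: k => [|k IHk].
  suff: nbhs x [set y : X | y.1 = x.1].
    by apply: filterS => y /= y1; congr pair.
  have := @discrete_set1 (discrete_topology 'I_r) x.1.
  exact: (@cvg_fst _ _ (nbhs x.1) (nbhs x.2) _ [set z | z = x.1]).
apply: filterS (filterI IHk (near_digit x k)) => y /= [[y1 y2] yk].
by congr pair => //; rewrite !mkseqS y2 yk.
Qed.

(** Each output digit depends only on a finite prefix of the input. *)
Lemma locally_repl_continuous F : locally_repl F -> continuous F.
Proof.
move=> LF x; rewrite /continuous_at [F x]surjective_pairing.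
have F_near i : nbhs x [set y | trunc (F y) i = trunc (F x) i].
  have [l [b [_ ib Fb]]] := locally_repl_deep x i LF.
  apply: filterS (near_trunc x l) => y /= yx.
  rewrite -[x in RHS](trunc_tail x l) -[y](trunc_tail y l) yx !Fb.
  by rewrite !trunc_prefix_cat.
have E : (fun y => ((F y).1, (F y).2)) = F by apply/funext => y; case: (F y).
rewrite -[X in fmap X _]E.
have cvg1 : (F y).1 @[y --> x] --> (F x).1.
  by apply/discrete_cvg; apply: filterS (F_near 0) => y [].
suff cvg2 : (F y).2 @[y --> x] --> (F x).2 by exact: (cvg_pair cvg1 cvg2).
apply/cvg_sup => i A [B [[C _ CB] /= Bx BA]].
apply: filterS (F_near i.+1) => y /(congr1 snd) /=; rewrite !mkseqS => /rcons_inj[_ yi].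
by apply: BA; rewrite -CB /= yi; rewrite -CB in Bx.
Qed.

End Replacements.

(** * Exchanging two cones *)

Section Swaps.
Variables n r : nat.
Local Notation X := (cantor n r).
Local Notation word := (prefix_word n r).
Local Notation repl := (@is_prefix_replacement n r).
Implicit Types (x y : X) (a b c d v : word) (F : X -> X).

Lemma incomparable_trunc a x k :
  ~~ in_cone a x -> len a <= k -> ~~ comparable a (trunc x k).
Proof.
move=> nax le_k; apply: contra nax => /comparable_le; rewrite len_trunc => /(_ le_k).
by move/prefix_of_cone; apply; exact: in_cone_trunc.
Qed.

Lemma incomparable_ext a b s t :
  ~~ comparable a b -> ~~ comparable (prefix_ext a s) (prefix_ext b t).
Proof. exact/contra/comparable_ext. Qed.

Lemma incomparable_siblings a i j s t :
  i != j -> ~~ comparable (prefix_ext a (i :: s)) (prefix_ext a (j :: t)).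
Proof.
move=> ij; apply/negP; rewrite -[i :: s]cat1s -[j :: t]cat1s -!prefix_ext_cat.
move=> /comparable_ext/comparable_eq; rewrite !len_ext => /(_ erefl) [].
by move/eqP; rewrite eqseq_cat // eqxx /= eqseq_cons (negPf ij).
Qed.

Definition swapf a b x : X :=
  if in_cone a x then prefix_cat b (tail x (len a))
  else if in_cone b x then prefix_cat a (tail x (len b)) else x.

Lemma swapf_l a b : repl (swapf a b) a b.
Proof. by move=> psi; rewrite /swapf in_cone_cat tail_prefix_cat. Qed.

Lemma swapf_out a b x : ~~ in_cone a x -> ~~ in_cone b x -> swapf a b x = x.
Proof. by rewrite /swapf => /negPf-> /negPf->. Qed.

Lemma swapf_fix a b c :
  ~~ comparable c a -> ~~ comparable c b -> repl (swapf a b) c c.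
Proof.
move=> nca ncb psi; have cx := in_cone_cat c psi.
by rewrite swapf_out ?(in_cone_disjoint _ cx).
Qed.

Lemma swapf_r a b : ~~ comparable a b -> repl (swapf a b) b a.
Proof.
move=> nab psi; have bx := in_cone_cat b psi; rewrite /swapf bx.
rewrite comparable_sym in nab.
by rewrite (negPf (in_cone_disjoint nab bx)) tail_prefix_cat.
Qed.

Lemma swapfK a b : ~~ comparable a b -> involutive (swapf a b).
Proof.
move=> nab x.
have [/in_coneE ->|nax] := boolP (in_cone a x); first by rewrite swapf_l swapf_r.
have [/in_coneE ->|nbx] := boolP (in_cone b x); first by rewrite swapf_r // swapf_l.
by rewrite !swapf_out // swapf_out.
Qed.

Lemma swapf_locally_repl a b : ~~ comparable a b -> locally_repl (swapf a b).
Proof.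
move=> nab x.
have [ax|nax] := boolP (in_cone a x).
  by exists a, b; split; [exact/in_coneP|exact: swapf_l].
have [bx|nbx] := boolP (in_cone b x).
  by exists b, a; split; [exact/in_coneP|exact: swapf_r].
pose c := trunc x (len a + len b); exists c, c; split.
  exact/in_coneP/in_cone_trunc.
by apply: swapf_fix; rewrite comparable_sym incomparable_trunc // ?leq_addr ?leq_addl.
Qed.

(** The word whose cone is the image of the cone of [v]; only meaningful when that
    cone is not cut by those of [a] and [b], which is what [swappable] says. *)
Definition swapw a b v : word :=
  if prefix_of a v then prefix_ext b (drop (len a) v.2)
  else if prefix_of b v then prefix_ext a (drop (len b) v.2) else v.

Definition swappable a b v :=
  [|| prefix_of a v, prefix_of b v | ~~ comparable v a && ~~ comparable v b].

Lemma swapw_repl a b v : ~~ comparable a b -> swappable a b v ->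
  repl (swapf a b) v (swapw a b v).
Proof.
move=> nab v_ok; rewrite /swapw; have [av|nav] := boolP (prefix_of a v).
  by rewrite {1}(prefix_ofE av); apply: repl_ext; apply: swapf_l.
have [bv|nbv] := boolP (prefix_of b v).
  by rewrite {1}(prefix_ofE bv); apply: repl_ext; apply: swapf_r.
move: v_ok; rewrite /swappable (negPf nav) (negPf nbv) => /andP[nva nvb].
exact: swapf_fix.
Qed.

End Swaps.

(** * The degree cocycle *)

Section Degree.
Variables n r : nat.
Local Notation X := (cantor n r).
Local Notation word := (prefix_word n r).
Local Notation repl := (@is_prefix_replacement n r).
Implicit Types (x y : X) (a b c d : word) (F G : X -> X).

(** The logarithm, in base [n], of the factor by which [F] shrinks the cones
    around [x]. *)
Definition degree_rel F x (k : int) := exists a b,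
  [/\ in_cone a x, repl F a b & k = ((len b)%:Z - (len a)%:Z)%R].

Lemma degree_relM F G x k l :
  degree_rel G x k -> degree_rel F (G x) l -> degree_rel (F \o G) x (l + k)%R.
Proof.
move=> [a [b [ax Gab ->]]] [c [d [cGx Fcd ->]]].
have [b' Gb' eb] := repl_trunc Gab ax (leq_addr (len c) _).
have b'x := repl_cone Gb' (in_cone_trunc _ _).
have /prefix_ofP[s sE] : prefix_of c b'.
  by apply: comparable_le; [exact: in_cone_comparable cGx b'x|lia].
exists (trunc x (len a + len c)), (prefix_ext d s); split.
- exact: in_cone_trunc.
- by apply: repl_comp Gb' _; rewrite sE; apply: repl_ext.
- by rewrite len_ext len_trunc; move: eb; rewrite sE len_ext; lia.
Qed.

Lemma degree_rel_exists F x : locally_repl F -> exists k, degree_rel F x k.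
Proof.
by move=> /(_ x)[a [b [/in_coneP ax Fab]]]; exists ((len b)%:Z - (len a)%:Z)%R, a, b.
Qed.

End Degree.

(** * Uniqueness and uniformity of local prefix replacements *)

Section Uniformity.
Variables n r : nat.
Hypothesis n_gt1 : 1 < n.
Local Notation X := (cantor n r).
Local Notation word := (prefix_word n r).
Local Notation repl := (@is_prefix_replacement n r).
Implicit Types (x y : X) (a b c d v : word) (F : X -> X).

Definition digit0 : 'I_n := Ordinal (ltnW n_gt1).
Definition digit1 : 'I_n := Ordinal n_gt1.

Lemma other_digit (i : 'I_n) : exists j, j != i.
Proof.
have [->|] := eqVneq i digit0; last by rewrite eq_sym; exists digit0.
by exists digit1.
Qed.

(** If one target were a proper extension of the other, all tails would start
    with the same digit. *)
Lemma repl_uniq F a b c : repl F a b -> repl F a c -> b = c.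
Proof.
move=> Fb Fc; wlog le_bc : b c Fb Fc / len b <= len c => [H|].
  by have [/H->|/ltnW/H->] := leqP (len b) (len c).
have E psi : prefix_cat b psi = prefix_cat c psi by rewrite -Fb Fc.
have [[|i s] c_def] := prefix_cat_comparable (E (fun=> digit0)) le_bc.
  by rewrite c_def prefix_ext0.
have [j ji] := other_digit i; have := E (fun=> j).
rewrite c_def prefix_cat_ext => /prefix_cat_inj /(congr1 (@^~ 0)) /= e.
by rewrite e eqxx in ji.
Qed.

Definition level_repl F N := forall a, len a = N -> exists b, repl F a b.

Lemma level_replW F N M : N <= M -> level_repl F N -> level_repl F M.
Proof.
move=> le_NM FN a aM; rewrite -aM in le_NM.
have aE : a = prefix_ext (a.1, take N a.2) (drop N a.2).
  by rewrite /prefix_ext /= cat_take_drop -surjective_pairing.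
have [|b Fb] := FN (a.1, take N a.2); first by rewrite /len size_takel.
by exists (prefix_ext b (drop N a.2)); rewrite {1}aE; apply: repl_ext.
Qed.

(** Koenig's lemma: a word all of whose extensions by one digit admit a uniform
    depth admits one itself, so a failure would propagate along an infinite
    path, contradicting local replacement at its end. *)
Lemma locally_repl_level F : locally_repl F -> exists N, level_repl F N.
Proof.
move=> LF.
pose good a := exists k, forall s, size s = k -> exists b, repl F (prefix_ext a s) b.
have good_uniform (I : finType) (f : I -> word) : (forall i, good (f i)) ->
    exists k, forall i s, size s = k -> exists b, repl F (prefix_ext (f i) s) b.
  move=> /choice[k k_good]; exists (\max_i k i) => i s size_s.
  have le_k : k i <= size s by rewrite size_s; apply: leq_bigmax.
  have [b Fb] := k_good i (take (k i) s) (size_takel le_k).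
  exists (prefix_ext b (drop (k i) s)).
  by rewrite -{1}[s](cat_take_drop (k i)) -prefix_ext_cat; apply: repl_ext.
have step a : exists i, ~ good a -> ~ good (prefix_ext a [:: i]).
  apply: contrapT => /forallNP no_bad.
  have [i|k k_good] := @good_uniform 'I_n (fun i => prefix_ext a [:: i]).
    by apply: contrapT => bad_i; apply: (no_bad i).
  apply: (no_bad digit0) => bad_a; case: bad_a; exists k.+1 => -[|i s] //= [size_s].
  by have [b] := k_good i s size_s; exists b; rewrite -cat1s -prefix_ext_cat.
have root_good (a0 : 'I_r) : good (a0, [::]).
  have [next next_bad] := choice step; apply: contrapT => bad0.
  (* Follow bad words for ever, starting from the empty one. *)
  pose path := fix path k := if k is k'.+1 then
    let s := path k' in rcons s (next (a0, s)) else [::].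
  pose x : X := (a0, fun i => next (a0, path i)).
  have pathE k : trunc x k = (a0, path k).
    congr pair; elim: k => // k IHk.
    by rewrite mkseqS IHk.
  have path_bad k : ~ good (trunc x k).
    rewrite pathE; elim: k => //= k /next_bad.
    by rewrite /prefix_ext /= cats1.
  have [a [b [/in_coneP ax Fab]]] := LF x; apply: (path_bad (len a)).
  by exists 0 => s /size0nil ->; exists b; rewrite prefix_ext0 (eqP ax).
have [N N_good] := @good_uniform 'I_r _ root_good; exists N => -[a0 s] sN.
exact: N_good.
Qed.

(** Two replacements valid near [x] agree on a smaller cone, and passing to a
    subcone lengthens source and target equally. *)
Lemma degree_rel_uniq F x k l : degree_rel F x k -> degree_rel F x l -> k = l.
Proof.
move=> [a [b [ax Fab ->]]] [c [d [cx Fcd ->]]].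
have [b' Fb' eb] := repl_trunc Fab ax (leq_addr (len c) _).
have [d' Fd' ed] := repl_trunc Fcd cx (leq_addl (len a) _).
by rewrite (repl_uniq Fd' Fb') in ed; lia.
Qed.

End Uniformity.

(** * The sign homomorphism for odd n *)

Lemma odd_sum (I : finType) (P : pred I) (f : I -> nat) :
  odd (\sum_(i | P i) f i) = \big[addb/false]_(i | P i) odd (f i).
Proof. exact: (big_morph odd oddD). Qed.

(** Sums over unordered pairs are turned into sums over all pairs, which can be
    regrouped along a map of the index set. *)
Lemma sum_sym_pairs (T : finType) (f : T -> T -> nat) :
  (forall s, f s s = 0) -> (forall s t, f s t = f t s) ->
  \sum_(p : T * T) f p.1 p.2 =
  (\sum_(p : T * T | enum_rank p.1 < enum_rank p.2) f p.1 p.2).*2.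
Proof.
move=> f0 f_sym; rewrite (bigID (fun p => enum_rank p.1 < enum_rank p.2)) /=.
rewrite -addnn; congr (_ + _).
rewrite (reindex_inj (h := fun p : T * T => (p.2, p.1))) /=; last first.
  by move=> [s t] [s' t'] [-> ->].
rewrite big_mkcond [RHS]big_mkcond /=; apply: eq_bigr => -[s t] _ /=.
rewrite -leqNgt f_sym leq_eqVlt; case: eqP => [/val_inj/enum_rank_inj->|//] /=.
by rewrite f0 if_same.
Qed.

Section Order.
Variables n r : nat.
Local Notation X := (cantor n r).
Local Notation word := (prefix_word n r).
Implicit Types (x y : X) (a b c d : word).

(** ** The lexicographic order *)

Definition lex_tail (phi psi : nat -> 'I_n) : bool :=
  `[< exists i, (forall j, j < i -> phi j = psi j) /\ phi i < psi i >].

Definition lex x y : bool :=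
  (x.1 < y.1) || (x.1 == y.1) && lex_tail x.2 y.2.

Lemma lex_tail_irr phi : lex_tail phi phi = false.
Proof. by apply/asboolP => -[i [_]]; rewrite ltnn. Qed.

Lemma lex_tailN phi psi : phi <> psi -> lex_tail psi phi = ~~ lex_tail phi psi.
Proof.
move=> neq; have [i [i_neq i_min]] : exists i,
    phi i != psi i /\ forall j, j < i -> phi j = psi j.
  have ex_i : exists i, phi i != psi i.
    apply: contrapT => /forallNP same; apply: neq; apply/funext => i.
    by apply/eqP; have /negP/negbNE := same i.
  case: (ex_minnP ex_i) => i i_neq i_min; exists i; split=> // j ji.
  by apply/eqP; apply: contraTT ji => /i_min; rewrite -leqNgt.
have lexE f g : f i != g i -> (forall j, j < i -> f j = g j) ->
    lex_tail f g = (f i < g i).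
  move=> fg_i fg_min; apply/asboolP/idP => [[k [k_min fg_k]]|fg]; last by exists i.
  have [ki|ik|<- //] := ltngtP k i; first by rewrite fg_min // ltnn in fg_k.
  by rewrite k_min // eqxx in fg_i.
rewrite (lexE phi psi) // (lexE psi phi) 1?eq_sym // => [|j /i_min //].
by rewrite -leqNgt [RHS]leq_eqVlt eq_sym (negPf i_neq : (phi i == psi i :> nat) = false).
Qed.

Lemma lex_irr x : lex x x = false.
Proof. by rewrite /lex ltnn eqxx lex_tail_irr. Qed.

Lemma lexN x y : x <> y -> lex y x = ~~ lex x y.
Proof.
case: x y => [x1 x2] [y1 y2] neq; rewrite /lex /= [y1 == x1]eq_sym.
have [e|ne] := eqVneq x1 y1; last first.
  by rewrite /= !orbF -leqNgt [RHS]leq_eqVlt eq_sym (negPf ne : (x1 == y1 :> nat) = false).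
by rewrite e ltnn /= lex_tailN // => e2; apply: neq; rewrite e e2.
Qed.

(** The first difference between points of two disjoint cones occurs within the
    two prefixes. *)
Lemma lex_cone a b x y x' y' : ~~ comparable a b ->
    in_cone a x -> in_cone b y -> in_cone a x' -> in_cone b y' ->
  lex x y = lex x' y'.
Proof.
move=> nab; suff imp (u v u' v' : X) : in_cone a u -> in_cone b v ->
    in_cone a u' -> in_cone b v' -> lex u v -> lex u' v'.
  by move=> ax b_y ax' b_y'; apply/idP/idP; apply: imp.
have digit c z z' i : in_cone c z -> in_cone c z' -> i < len c -> z.2 i = z'.2 i.
  move=> /eqP cz /eqP cz' ic; move: (etrans cz (esym cz')) => /(congr1 snd) /= e.
  by have := congr1 (nth (z.2 i) ^~ i) e; rewrite !nth_mkseq.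
have head c z : in_cone c z -> z.1 = c.1 by move=> /eqP <-.
move=> au bv au' bv'; rewrite /lex !(head _ _ au, head _ _ bv, head _ _ au', head _ _ bv').
case: ltnP => //= _; have [e|//] := eqVneq a.1 b.1 => /= /asboolP[i [i_min lt_i]].
have i_small : i < minn (len a) (len b).
  rewrite ltnNge; apply: contra nab => le_i.
  have E k : k <= i -> trunc u k = trunc v k.
    move=> le_k; congr pair; first by rewrite (head _ _ au) (head _ _ bv).
    apply: (@eq_from_nth _ (u.2 0)); rewrite !size_mkseq // => j jk.
    by rewrite !nth_mkseq // i_min //; apply: leq_trans jk le_k.
  have [le_ab|/ltnW le_ba] := leqP (len a) (len b).
    apply: (in_cone_comparable _ bv); rewrite /in_cone -E ?(eqP au) //.
    by rewrite (minn_idPl le_ab) in le_i.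
  apply: (in_cone_comparable au _); rewrite /in_cone E ?(eqP bv) //.
  by rewrite (minn_idPr le_ba) in le_i.
rewrite leq_min in i_small; case/andP: i_small => ia ib.
apply/asboolP; exists i; split=> [j ji|].
  rewrite -(digit a u u') -?(digit b v v') ?i_min //.
    exact: ltn_trans ji ib.
  exact: ltn_trans ji ia.
by rewrite -(digit a u u') -?(digit b v v').
Qed.

Lemma lex_prefix_cat a phi psi :
  lex (prefix_cat a phi) (prefix_cat a psi) = lex_tail phi psi.
Proof.
rewrite /lex ltnn eqxx /=; apply/asboolP/asboolP => -[i [i_min lt_i]].
  have le_i : len a <= i.
    rewrite leqNgt; apply/negP => ia; move: lt_i => /=.
    by rewrite (set_nth_default (psi (i - len a)) _ ia) ltnn.
  exists (i - len a); split=> [j ji|]; last by move: lt_i; rewrite /= !nth_default.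
  have := i_min (len a + j); rewrite /= !nth_default ?leq_addr // addKn; apply.
  by rewrite -ltn_subRL.
exists (len a + i); split=> [j ji|].
  rewrite /=; have [ja|aj] := ltnP j (len a); first exact: set_nth_default.
  by rewrite !nth_default // -/(len a) i_min //; lia.
by rewrite /= !nth_default ?leq_addr // addKn.
Qed.

End Order.

(** ** Inversions *)

Section Inversions.
Variables n r : nat.
Hypothesis n_gt1 : 1 < n.
Local Notation X := (cantor n r).
Local Notation word := (prefix_word n r).
Local Notation repl := (@is_prefix_replacement n r).
Implicit Types (x y : X) (a b c d : word) (F : X -> X).

Definition level N : finType := ('I_r * N.-tuple 'I_n)%type.

Definition level_word N (w : level N) : word := (w.1, tval w.2).

Definition level_of N x : level N := (x.1, [tuple of mkseq x.2 N]).

Definition level_point N (w : level N) : X :=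
  prefix_cat (level_word w) (fun=> digit0 n_gt1).

Lemma len_level_word N (w : level N) : len (level_word w) = N.
Proof. exact: size_tuple. Qed.

Lemma level_word_inj N : injective (@level_word N).
Proof. by case=> [a u] [b v] [-> e]; congr pair; apply: val_inj. Qed.

Lemma level_word_of N x : level_word (level_of N x) = trunc x N.
Proof. by []. Qed.

Lemma level_wordP N a : len a = N -> exists w : level N, level_word w = a.
Proof.
move=> aN; have sN : size a.2 == N by apply/eqP.
by exists (a.1, Tuple sN); rewrite /level_word /= -surjective_pairing.
Qed.

Lemma level_ofP N x (w : level N) : (level_of N x == w) = in_cone (level_word w) x.
Proof.
rewrite /in_cone len_level_word -level_word_of.
by rewrite (inj_eq (@level_word_inj N)).
Qed.

Lemma comparable_level N (u v : level N) :
  comparable (level_word u) (level_word v) = (u == v).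
Proof.
apply/idP/eqP => [|->]; last exact: comparable_refl.
by move/comparable_eq; rewrite !len_level_word => /(_ erefl)/level_word_inj.
Qed.

Lemma level_point_cone N (w : level N) : in_cone (level_word w) (level_point w).
Proof. exact: in_cone_cat. Qed.

Lemma level_pointK N : cancel (@level_point N) (level_of N).
Proof. by move=> w; apply/eqP; rewrite level_ofP level_point_cone. Qed.

Definition inverts F x y : bool := lex x y (+) lex (F x) (F y).

Lemma inverts_refl F x : inverts F x x = false.
Proof. by rewrite /inverts !lex_irr. Qed.

Lemma inverts_sym F x y : injective F -> inverts F x y = inverts F y x.
Proof.
move=> F_inj; have [->//|neq] := pselect (x = y).
rewrite /inverts (@lexN _ _ x y) // (@lexN _ _ (F x) (F y)) => [|/F_inj //].
by rewrite addbN addNb negbK.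
Qed.

Lemma invertsM F G x y :
  inverts (F \o G) x y = inverts G x y (+) inverts F (G x) (G y).
Proof. by rewrite /inverts addbA addbK. Qed.

(** The enumeration order of [T] only serves to list unordered pairs. *)
Definition inversion_parity (T : finType) F (e : T -> X) : bool :=
  odd (\sum_(p : T * T | enum_rank p.1 < enum_rank p.2)
         inverts F (e p.1) (e p.2)).

Lemma inversion_parityM (T : finType) F G (e : T -> X) :
  inversion_parity (F \o G) e = inversion_parity G e (+) inversion_parity F (G \o e).
Proof.
rewrite /inversion_parity !odd_sum -big_split /=; apply: eq_bigr => p _.
by rewrite invertsM !oddb.
Qed.

(** Samples that meet every cone of some level an odd number of times compute
    the same parity for every injection that acts on the cones of that level by
    prefix replacement. *)
Definition odd_on (T : finType) (e : T -> X) a := odd #|[pred s | in_cone a (e s)]|.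

(** Two points of the same cone are never inverted, since prefix replacement
    preserves the order; those of disjoint cones are compared by their prefixes,
    before and after applying [F]. *)
Lemma inverts_level F N (u v : level N) x y : injective F -> level_repl F N ->
    in_cone (level_word u) x -> in_cone (level_word v) y ->
  inverts F x y = inverts F (level_point u) (level_point v).
Proof.
move=> F_inj FN ux vy; have [b Fb] := FN _ (len_level_word u).
have [uv|neq] := eqVneq u v.
  rewrite -uv in vy *; rewrite inverts_refl /inverts.
  by rewrite (in_coneE ux) (in_coneE vy) !Fb !lex_prefix_cat addbb.
have [c Fc] := FN _ (len_level_word v).
have nuv : ~~ comparable (level_word u) (level_word v) by rewrite comparable_level.
have nbc : ~~ comparable b c.
  apply: contra nuv => /orP[] /prefix_ofP[s E].
    have := Fc (fun=> digit0 n_gt1); rewrite E prefix_cat_ext -Fb => /F_inj e.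
    have := in_cone_cat (level_word v) (fun=> digit0 n_gt1); rewrite e.
    exact/in_cone_comparable/in_cone_cat.
  have := Fb (fun=> digit0 n_gt1); rewrite E prefix_cat_ext -Fc => /F_inj e.
  have := in_cone_cat (level_word u) (fun=> digit0 n_gt1); rewrite e => /in_cone_comparable.
  by apply; apply: in_cone_cat.
have [pu pv] := (level_point_cone u, level_point_cone v).
rewrite /inverts (lex_cone nuv ux vy pu pv); congr addb.
by apply: (lex_cone nbc); apply: repl_cone; eauto.
Qed.

(** Pairs of sample points are sorted by the pair of cones containing them; a
    pair of cones is counted an odd number of times. *)
Lemma inversion_parity_stable (T : finType) F (e : T -> X) N :
    injective F -> level_repl F N ->
    (forall a, len a = N -> odd_on e a) ->
  inversion_parity F e = inversion_parity F (@level_point N).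
Proof.
move=> F_inj FN e_odd.
pose D (u v : level N) : nat := inverts F (level_point u) (level_point v).
pose m (u : level N) := #|[pred s | level_of N (e s) == u]|.
have m_odd u : odd (m u).
  have := e_odd _ (len_level_word u); rewrite /odd_on; congr odd.
  by apply: eq_card => s; rewrite !inE level_ofP.
have D_sym (u v : level N) : D u v = D v u by rewrite /D inverts_sym.
have D0 u : D u u = 0 by rewrite /D inverts_refl.
suff E : \sum_(p : T * T | enum_rank p.1 < enum_rank p.2)
            inverts F (e p.1) (e p.2) =
         \sum_(p : level N * level N | enum_rank p.1 < enum_rank p.2)
            m p.1 * m p.2 * D p.1 p.2.
  rewrite /inversion_parity E !odd_sum; apply: eq_bigr => p _.
  by rewrite !oddM !m_odd.
apply: double_inj.
rewrite -(@sum_sym_pairs _ (fun s t => inverts F (e s) (e t) : nat)); first last.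
- by move=> s t; rewrite inverts_sym.
- by move=> s; rewrite inverts_refl.
rewrite -(@sum_sym_pairs _ (fun u v => m u * m v * D u v)); first last.
- by move=> u v; rewrite D_sym [m u * _]mulnC.
- by move=> u; rewrite D0 muln0.
rewrite (partition_big (fun p : T * T => (level_of N (e p.1), level_of N (e p.2)))
           predT) //=.
apply: eq_bigr => -[u v] _.
rewrite (eq_bigr (fun=> D u v)) => [|[s t] /= /eqP[su tv]]; last first.
  by rewrite /D -(@inverts_level _ _ _ _ (e s) (e t)) // -level_ofP ?su ?tv.
rewrite sum_nat_const; congr (_ * _); rewrite /m -cardX.
by apply: eq_card => -[s t]; rewrite !inE.
Qed.

Section OddBase.
Hypothesis n_odd : odd n.

(** A cone is the disjoint union of its [n] subcones, and [n] is odd. *)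
Lemma odd_on_ext (T : finType) (e : T -> X) a k :
  (forall s, size s = k -> odd_on e (prefix_ext a s)) -> odd_on e a.
Proof.
elim: k a => [|k IHk] a a_odd; first by rewrite -[a]prefix_ext0 a_odd.
have ai_odd i : odd_on e (prefix_ext a [:: i]).
  by apply: IHk => s sk; rewrite prefix_ext_cat a_odd /= ?sk.
rewrite /odd_on -sum1_card (partition_big (fun s => (e s).2 (len a)) predT) //=.
rewrite odd_sum (eq_bigr (fun=> true)) => [|i _].
  have iterE m : iter m (addb true) false = odd m by elim: m => //= m ->.
  by rewrite big_const card_ord iterE.
have /esym := ai_odd i; rewrite /odd_on -sum1_card => ->; congr odd.
apply: eq_bigl => s; rewrite !inE in_cone_ext; congr andb.
rewrite /in_cone /trunc /= /mkseq /= /tail addn0.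
by rewrite xpair_eqE eqxx /= eqseq_cons andbT.
Qed.

Lemma odd_on_level_point M a : len a <= M -> odd_on (@level_point M) a.
Proof.
move=> aM; apply: (@odd_on_ext _ _ _ (M - len a)) => s sE.
have [|w <-] := @level_wordP M (prefix_ext a s); first by rewrite len_ext; lia.
rewrite /odd_on (@eq_card1 _ w) // => v; rewrite !inE -level_ofP level_pointK.
by [].
Qed.

(** The common value of the parities for all samples of large level. *)
Definition sign F : bool :=
  `[< exists N, forall M, N <= M -> inversion_parity F (@level_point M) = true >].

Lemma signE F N : injective F -> level_repl F N ->
  inversion_parity F (@level_point N) = sign F.
Proof.
move=> F_inj FN.
have stable M : N <= M ->
    inversion_parity F (@level_point M) = inversion_parity F (@level_point N).
  by move=> NM; apply: inversion_parity_stable => // a aN; apply: odd_on_level_point; lia.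
apply/idP/asboolP => [FNt|[K K_true]]; first by exists N => M /stable ->.
by rewrite -(stable (maxn N K)) ?leq_maxl // K_true // leq_maxr.
Qed.

(** Since [inverts] is a cocycle, the parity of [F \o G] is that of [G] plus that
    of [F] for the sample moved by [G]. The moved sample is still odd on cones,
    because [G'] maps the cones of a large level onto cones. *)
Lemma signM F F' G G' : cancel F F' -> cancel F' F -> cancel G G' -> cancel G' G ->
    locally_repl F -> locally_repl G -> locally_repl G' ->
  sign (F \o G) = sign F (+) sign G.
Proof.
move=> FK F'K GK G'K LF LG LG'.
have [F_inj G_inj] := (can_inj FK, can_inj GK).
have FG_inj : injective (F \o G) by apply: inj_comp.
have [NF hF] := locally_repl_level n_gt1 LF.
have [NG hG] := locally_repl_level n_gt1 LG.
have [N hFG] := locally_repl_level n_gt1 (locally_repl_comp LF LG).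
have [N' hG'] := locally_repl_level n_gt1 LG'.
pose K := maxn NF N'; have {}hG' : level_repl G' K.
  by apply: level_replW hG'; apply: leq_maxr.
have /choice[b G'b] : forall w : level K, exists b, repl G' (level_word w) b.
  by move=> w; apply: hG'; apply: len_level_word.
(* Large enough for the images under [G'] of all cones of level [K]. *)
pose M := maxn N (maxn NG (\max_w len (b w))).
have hM := inversion_parity_stable (e := G \o @level_point M) F_inj hF.
rewrite -(signE F_inj hF) -hM; last first.
  move=> a aNF; apply: (@odd_on_ext _ _ _ (K - NF)) => s sE.
  have [|w <-] := @level_wordP K (prefix_ext a s).
    by rewrite len_ext sE aNF subnKC // leq_maxl.
  have -> : odd_on (G \o @level_point M) (level_word w) = odd_on (@level_point M) (b w).
    rewrite /odd_on; congr odd; apply: eq_card => v; rewrite !inE /=.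
    apply/idP/idP => [Gv|/in_coneE ->].
      by rewrite -(GK (level_point v)); apply: repl_cone (G'b w) Gv.
    by rewrite -G'b G'K in_cone_cat.
  apply: odd_on_level_point; rewrite /M !leq_max; apply/orP; right.
  by apply/orP; right; apply: (@leq_bigmax _ (fun w => len (b w))).
have MN : level_repl (F \o G) M by apply: level_replW hFG; apply: leq_maxl.
have MG : level_repl G M by apply: level_replW hG; rewrite /M !leq_max leqnn orbT.
by rewrite -(signE FG_inj MN) inversion_parityM -(signE G_inj MG) addbC.
Qed.

End OddBase.
End Inversions.

(** * Abelianizations *)

Section AbelianizationTheory.
Local Open Scope group_scope.
Variable G : groupType.
Implicit Types x y s t u : G.

Lemma ab_proj_mul x y : ab_proj (x * y) = ab_proj x * ab_proj y.
Proof. exact: ab_projM. Qed.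

Lemma ab_proj1 : ab_proj (1 : G) = 1.
Proof. by []. Qed.

Lemma ab_proj_conj u s t : u * s = t * u -> ab_proj s = ab_proj t.
Proof.
move=> us_tu; apply/ab_projP; have -> : t = u * s * u^-1 by rewrite us_tu mulgK.
suff -> : s^-1 * (u * s * u^-1) = [~ s, u^-1] by exact: commutator_subgroupR.
by rewrite /commg /conjg invgK !mulgA.
Qed.

Lemma additive_ab_proj (H : zmodType) (phi : G -> H) x y :
    (forall x y, phi (x * y) = (phi x + phi y)%R) ->
  ab_proj x = ab_proj y -> phi x = phi y.
Proof.
move=> phiM.
have phi1 : phi 1 = 0%R.
  by apply: (GRing.addrI (phi 1)); rewrite -phiM mulg1 GRing.addr0.
have phiV z : phi z^-1 = (- phi z)%R.
  by apply: (GRing.addrI (phi z)); rewrite -phiM mulgV GRing.subrr.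
move=> /ab_projP xy; suff : phi (x^-1 * y) = 0%R.
  by rewrite phiM phiV GRing.addrC => /eqP; rewrite GRing.subr_eq0 => /eqP.
pose K := [set z | phi z = 0%R]%classic.
apply: (xy K); split=> [|_ [y1 _ [z1 _ <-]]].
  split=> [|z1 z2 /set_mem Kz1 /set_mem Kz2]; apply/mem_set => //.
  by rewrite /K /= phiM phiV Kz1 Kz2 GRing.subrr.
rewrite /K /= /commg /conjg !phiM !phiV.
by rewrite [(phi y1 + phi z1)%R]GRing.addrC GRing.addKr GRing.addNr.
Qed.

Lemma abelianization_isomorphic (H : zmodType) (phi : G -> H) :
    (forall x y, phi (x * y) = (phi x + phi y)%R) ->
    (forall h, exists x, phi x = h) ->
    (forall x, phi x = 0%R -> ab_proj x = 1) ->
  isomorphic_groups (abelianization G) (Algebra.to_multiplicative H).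
Proof.
move=> phiM phi_surj phi_ker.
have phi_repr x : phi (repr (ab_proj x)) = phi x.
  by apply: (additive_ab_proj phiM); rewrite ab_projK.
pose f (u : abelianization G) : Algebra.to_multiplicative H := phi (repr u).
have fM : {morph f : u v / u * v}.
  by move=> u v; rewrite /f -[in LHS](ab_projK u) -[in LHS](ab_projK v) -ab_proj_mul
    phi_repr phiM.
pose mixin := isMultiplicative.Build _ _ f fM.
pose fm : {multiplicative abelianization G -> Algebra.to_multiplicative H} :=
  HB.pack f mixin.
exists fm; have [s sP] := choice phi_surj.
exists (fun h => ab_proj (s h)) => [u|h]; last by rewrite /= /f phi_repr sP.
have phi_diff x y : phi x = phi y -> phi (x^-1 * y) = 0%R.
  by move=> xy; apply: (GRing.addrI (phi x)); rewrite -phiM mulVKg GRing.addr0.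
rewrite /= /f -[RHS]ab_projK; apply/ab_projP.
have /phi_diff/phi_ker : phi (s (phi (repr u))) = phi (repr u) by rewrite sP.
by move=> /esym/ab_projP; rewrite invg1 mul1g.
Qed.

End AbelianizationTheory.

(** * Elements of the stabilizer *)

Section Stabilizer.
Variables n r : nat.
Hypothesis n_gt1 : 1 < n.
Local Notation X := (cantor n r).
Local Notation word := (prefix_word n r).
Local Notation repl := (@is_prefix_replacement n r).
Variable S : {fset X}.
Implicit Types (x y : X) (a b c d : word) (F : X -> X).

Definition stabilizer : groupType := Fix (fun x : X => x \in S).
Implicit Types (g h : stabilizer).

Definition act g : X -> X := homeo_fun (val (val g)).

Lemma act1 : act 1%g = id.
Proof. by rewrite /act !val1. Qed.

Lemma actM g h : act (g * h)%g = act g \o act h.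
Proof. by rewrite /act !valM. Qed.

Lemma act_inj g h : act g =1 act h -> g = h.
Proof. by move=> gh; apply: val_inj; apply: val_inj; apply: homeo_eq. Qed.

Lemma actK g : cancel (act g) (act g^-1%g).
Proof. by move=> x; rewrite -[act g^-1%g _]/((act g^-1%g \o act g) x) -actM mulVg act1. Qed.

Lemma actVK g : cancel (act g^-1%g) (act g).
Proof. by move=> x; rewrite -[LHS]/((act g \o act g^-1%g) x) -actM mulgV act1. Qed.

Lemma act_locally_repl g : locally_repl (act g).
Proof. by have /asboolP := valP (val g). Qed.

Lemma act_fix g x : x \in S -> act g x = x.
Proof. by have /asboolP := valP g; apply. Qed.

Lemma stabilizer_build F F' : cancel F F' -> cancel F' F ->
    locally_repl F -> locally_repl F' -> (forall x, x \in S -> F x = x) ->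
  exists g, act g = F.
Proof.
move=> FK F'K LF LF' F_fix.
pose h := Homeo FK F'K (locally_repl_continuous LF) (locally_repl_continuous LF').
have hP : `[< thompson_like h >] by apply/asboolP.
pose k : higman_thompson n r := exist _ h hP.
have kP : `[< fixes (fun x : X => x \in S) k >] by apply/asboolP.
by exists (exist _ k kP).
Qed.

Definition avoids a := forall x, x \in S -> ~~ in_cone a x.

Lemma avoids_prefix a b : prefix_of a b -> avoids a -> avoids b.
Proof. by move=> ab Sa x /Sa; apply: contra; apply: prefix_of_cone. Qed.

Lemma swap_build a b : ~~ comparable a b -> avoids a -> avoids b ->
  exists g, act g = swapf a b.
Proof.
move=> nab Sa Sb; apply: stabilizer_build (swapfK nab) (swapfK nab) _ _ _.
- exact: swapf_locally_repl.
- exact: swapf_locally_repl.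
- by move=> x xS; rewrite swapf_out ?Sa ?Sb.
Qed.

(** As there are two digits, one more digit is enough to avoid one more point. *)
Lemma avoids_ext a : exists s, avoids (prefix_ext a s).
Proof.
suff [s sP] : exists s, forall x, x \in (S : seq X) -> ~~ in_cone (prefix_ext a s) x.
  by exists s.
elim: (S : seq X) => [|x l [s sP]]; first by exists [::].
pose b := prefix_ext a s.
have [i bi] : exists i, ~~ in_cone (prefix_ext b [:: i]) x.
  have [x0|?] := boolP (in_cone (prefix_ext b [:: digit0 n_gt1]) x).
    exists (digit1 n_gt1); apply: in_cone_disjoint x0.
    exact: (@incomparable_siblings n r b (digit0 n_gt1) (digit1 n_gt1) [::] [::]).
  by exists (digit0 n_gt1).
exists (s ++ [:: i]) => y; rewrite inE -prefix_ext_cat => /orP[/eqP->//|/sP].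
exact/contra/prefix_of_cone/prefix_of_ext.
Qed.

(** ** Conjugacy of small exchanges *)

(** The bound on the lengths ensures that the cones of two such exchanges never
    cover the whole space. *)
Definition small_swap a b :=
  [/\ ~~ comparable a b, avoids a, avoids b, 2 < len a & 2 < len b].

(** Here [t] is the conjugate of [s] by [u]. *)
Lemma swap_conj (u s t : stabilizer) a b c d : ~~ comparable a b -> ~~ comparable c d ->
    act s = swapf a b -> act t = swapf c d -> repl (act u) a c -> repl (act u) b d ->
  ab_proj s = ab_proj t.
Proof.
move=> nab ncd sE tE uac ubd; apply: (@ab_proj_conj _ u); apply: act_inj => x.
rewrite !actM /= sE tE.
have [/in_coneE ->|nax] := boolP (in_cone a x); first by rewrite swapf_l uac swapf_l ubd.
have [/in_coneE ->|nbx] := boolP (in_cone b x).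
  by rewrite swapf_r // ubd swapf_r // uac.
have out e e' : repl (act u) e e' -> ~~ in_cone e x -> ~~ in_cone e' (act u x).
  move=> ue; apply: contra => /in_coneE E.
  by rewrite -[x](actK u) E -ue actK in_cone_cat.
by rewrite (swapf_out nax nbx) (swapf_out (out _ _ uac nax) (out _ _ ubd nbx)).
Qed.

(** Conjugate by the product of the exchanges of [a] with [c] and of [b] with
    [d]. *)
Lemma small_swap_disjoint (s t : stabilizer) a b c d : small_swap a b -> small_swap c d ->
    [/\ ~~ comparable a c, ~~ comparable a d, ~~ comparable b c & ~~ comparable b d] ->
    act s = swapf a b -> act t = swapf c d ->
  ab_proj s = ab_proj t.
Proof.
move=> [nab Sa Sb _ _] [ncd Sc Sd _ _] [nac nad nbc nbd] sE tE.
have [u uE] := swap_build nac Sa Sc; have [v vE] := swap_build nbd Sb Sd.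
apply: (@swap_conj (u * v)%g _ _ a b c d) => //; rewrite actM uE vE.
  apply: (@repl_comp _ _ _ _ _ a); last exact: swapf_l.
  exact: swapf_fix.
apply: (@repl_comp _ _ _ _ _ d); first exact: swapf_l.
by apply: swapf_fix; rewrite comparable_sym.
Qed.

Hypothesis r_gt0 : 0 < r.

(** There are at least eight words of length three, so one of them is
    incomparable with any four given longer words. The exchange of two cones
    below it is conjugate to both given exchanges. *)
Lemma small_swap_eq (s t : stabilizer) a b c d : small_swap a b -> small_swap c d ->
    act s = swapf a b -> act t = swapf c d ->
  ab_proj s = ab_proj t.
Proof.
move=> ab cd sE tE.
pose cut a : level n r 3 := level_of 3 (prefix_cat a (fun=> digit0 n_gt1)).
have cutP e w : 2 < len e -> cut e != w -> ~~ comparable e (level_word w).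
  move=> e3; rewrite level_ofP; apply: contra => ew.
  have /prefix_of_cone : prefix_of (level_word w) e.
    by rewrite comparable_sym in ew; apply: comparable_le => //; rewrite len_level_word.
  by apply; apply: in_cone_cat.
have [w wP] : exists w, w \notin [:: cut a; cut b; cut c; cut d].
  apply: contrapT => /forallNP all_cut.
  have : #|level n r 3| <= size [:: cut a; cut b; cut c; cut d].
    apply: leq_trans (card_size _); apply: subset_leq_card; apply/fintype.subsetP => w _.
    by have /negP/negbNE := all_cut w.
  rewrite card_prod card_tuple !card_ord /= => le4.
  have : 2 ^ 3 <= r * n ^ 3 by rewrite -[2 ^ 3]mul1n leq_mul // leq_exp2r.
  by lia.
move: wP; rewrite !inE !negb_or ![w == _]eq_sym => /and4P[aw bw cw dw].
have [v vS] := avoids_ext (level_word w).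
pose e i := prefix_ext (prefix_ext (level_word w) v) [:: i].
have eS i : avoids (e i) by apply: avoids_prefix vS; apply: prefix_of_ext.
have ee : ~~ comparable (e (digit0 n_gt1)) (e (digit1 n_gt1)).
  exact: (@incomparable_siblings n r _ (digit0 n_gt1) (digit1 n_gt1) [::] [::]).
have [m mE] := swap_build ee (eS _) (eS _).
have len_e i : 2 < len (e i) by rewrite !len_ext len_level_word.
have ext c' i : 2 < len c' -> cut c' != w -> ~~ comparable c' (e i).
  move=> c3 /(cutP _ _ c3) nc; rewrite -[c']prefix_ext0 /e prefix_ext_cat.
  exact: incomparable_ext.
have e_small : small_swap (e (digit0 n_gt1)) (e (digit1 n_gt1)) by split.
have [_ _ _ a3 b3] := ab; have [_ _ _ c3 d3] := cd.
rewrite (small_swap_disjoint ab e_small _ sE mE); last by split; apply: ext.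
by rewrite (small_swap_disjoint cd e_small _ tE mE) //; split; apply: ext.
Qed.

(** Sibling cones make the sign computable: no other cone lies between them in
    the lexicographic order. *)
Lemma sibling_swap_exists : exists t a,
  small_swap (prefix_ext a [:: digit0 n_gt1]) (prefix_ext a [:: digit1 n_gt1]) /\
  act t = swapf (prefix_ext a [:: digit0 n_gt1]) (prefix_ext a [:: digit1 n_gt1]).
Proof.
have [s sS] := avoids_ext (Ordinal r_gt0, nseq 3 (digit0 n_gt1)).
pose a := prefix_ext (Ordinal r_gt0, nseq 3 (digit0 n_gt1)) s.
have small : small_swap (prefix_ext a [:: digit0 n_gt1]) (prefix_ext a [:: digit1 n_gt1]).
  split=> //; try by rewrite !len_ext.
  - exact: (@incomparable_siblings n r _ (digit0 n_gt1) (digit1 n_gt1) [::] [::]).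
  - exact: avoids_prefix (prefix_of_ext _ _) sS.
  - exact: avoids_prefix (prefix_of_ext _ _) sS.
have [nab Sa Sb _ _] := small; have [t tE] := swap_build nab Sa Sb.
by exists t, a.
Qed.

End Stabilizer.

(** * Elements that are trivial near the fixed points *)

Section Generation.
Variables n r : nat.
Hypotheses (n_gt1 : 1 < n) (r_gt0 : 0 < r).
Local Notation X := (cantor n r).
Local Notation word := (prefix_word n r).
Local Notation repl := (@is_prefix_replacement n r).
Variable S : {fset X}.
Local Notation G := (stabilizer S).
Implicit Types (x y : X) (a b c d : word) (g h : G).

Variables (t : G) (a0 b0 : word).
Hypotheses (small0 : small_swap S a0 b0) (tE : act t = swapf a0 b0).
Local Notation tau := (ab_proj t).

Lemma tau_sq : (tau * tau = 1)%g.
Proof.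
rewrite -ab_proj_mul (_ : t * t = 1)%g //; apply: act_inj => x.
by rewrite actM tE act1 /= swapfK //; case: small0.
Qed.

(** Multiplying by a small exchange preserves this condition, so it holds for all
    products of small exchanges. *)
Definition tau_class h := ab_proj h = 1%g \/ ab_proj h = tau.

Section Tables.
Variable N : nat.
Hypothesis N_gt2 : 2 < N.
Local Notation lvl := (level n r N).
Implicit Types (u v w : lvl) (tb : lvl -> word).

(** As the cones around the fixed points stay in place, the exchanges used to
    simplify a table concern cones that avoid [S]. *)
Definition table h tb := forall w,
  [/\ repl (act h) (level_word w) (tb w), 2 < len (tb w) &
      forall x, x \in S -> in_cone (level_word w) x -> tb w = level_word w].

Lemma table_code h tb v w : table h tb -> comparable (tb v) (tb w) -> v = w.
Proof.
move=> htb; suff pre v' w' : prefix_of (tb v') (tb w') -> v' = w'.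
  by case/orP => /pre.
have [[hv _ _] [hw _ _]] := (htb v', htb w').
case/prefix_ofP=> s E; have := hw (fun=> digit0 n_gt1).
rewrite E prefix_cat_ext -hv => /(can_inj (actK h)) e.
apply/eqP; rewrite -comparable_level.
have := in_cone_cat (level_word w') (fun=> digit0 n_gt1).
by rewrite e; apply/in_cone_comparable/in_cone_cat.
Qed.

Lemma table_cone h tb v w x :
  table h tb -> in_cone (tb v) x -> in_cone (tb w) x -> v = w.
Proof. by move=> htb vx wx; apply: table_code htb (in_cone_comparable vx wx). Qed.

Lemma table_cover h tb y : table h tb -> exists w, in_cone (tb w) y.
Proof.
move=> htb; pose x := act h^-1%g y; exists (level_of N x).
have [hw _ _] := htb (level_of N x); rewrite -(actVK h y).
by apply: (repl_cone hw); rewrite -level_ofP.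
Qed.

Lemma table_fixed h tb x : table h tb -> x \in S ->
  tb (level_of N x) = level_word (level_of N x) /\ in_cone (tb (level_of N x)) x.
Proof.
move=> htb xS; have [_ _ /(_ x xS)] := htb (level_of N x).
have Nx : in_cone (level_word (level_of N x)) x by rewrite -level_ofP.
by move=> /(_ Nx) ->.
Qed.

Lemma table_swap h tb c d : table h tb -> small_swap S c d ->
    (forall w, swappable c d (tb w)) ->
  exists h', table h' (swapw c d \o tb) /\ (tau_class h' -> tau_class h).
Proof.
move=> htb cd sw; have [ncd Sc Sd c3 d3] := cd.
have [s sE] := swap_build ncd Sc Sd; exists (s * h)%g; split=> [w|]; last first.
  rewrite /tau_class ab_proj_mul (small_swap_eq n_gt1 r_gt0 cd small0 sE tE).
  have E : ab_proj h = (tau * (tau * ab_proj h))%g by rewrite mulgA tau_sq mul1g.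
  by case=> e; [right | left]; rewrite E e ?mulg1 ?tau_sq.
have [hw w3 w_fix] := htb w; split.
- by rewrite actM sE; apply: repl_comp hw (swapw_repl ncd (sw w)).
- by rewrite /= /swapw; do 2?[case: ifP => _]; rewrite ?len_ext; lia.
- move=> x xS wx; have twx := w_fix x xS wx; rewrite /= /swapw twx.
  case: ifP => [/prefix_of_cone/(_ wx)|_]; first by rewrite (negPf (Sc x xS)).
  by case: ifP => [/prefix_of_cone/(_ wx)|//]; rewrite (negPf (Sd x xS)).
Qed.

(** The word of level [N] obtained from [tb w] by cutting it if it is long and by
    appending zeros if it is short. *)
Definition pad tb w : lvl := level_of N (prefix_cat (tb w) (fun=> digit0 n_gt1)).

Lemma pad_cone tb w :
  in_cone (level_word (pad tb w)) (prefix_cat (tb w) (fun=> digit0 n_gt1)).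
Proof. by rewrite -level_ofP. Qed.

Lemma pad_prefix tb w : len (tb w) <= N -> prefix_of (tb w) (level_word (pad tb w)).
Proof.
move=> wN; apply: comparable_le; last by rewrite len_level_word.
exact: in_cone_comparable (in_cone_cat _ _) (pad_cone tb w).
Qed.

Lemma prefix_pad tb w : N <= len (tb w) -> prefix_of (level_word (pad tb w)) (tb w).
Proof.
move=> wN; apply: comparable_le; last by rewrite len_level_word.
exact: in_cone_comparable (pad_cone tb w) (in_cone_cat _ _).
Qed.

(** Padding short images injects the words of level [N] into themselves, so it
    is onto and leaves no room for an image shorter than [N]. *)
Lemma table_len_le h tb : table h tb ->
  (forall w, len (tb w) <= N) -> forall w, len (tb w) = N.
Proof.
move=> htb le_N w; apply/eqP; rewrite eqn_leq le_N leqNgt; apply/negP => ltN.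
have pad_inj : injective (pad tb).
  move=> u v e; apply: (table_cone (x := level_point n_gt1 (pad tb u)) htb).
    exact: prefix_of_cone (pad_prefix (le_N u)) (level_point_cone _ _).
  by rewrite e; apply: prefix_of_cone (pad_prefix (le_N v)) (level_point_cone _ _).
pose y := prefix_cat (tb w) (fun=> digit1 n_gt1).
have [v vE] : exists v, pad tb v = level_of N y.
  by have [g _ gK] := injF_bij pad_inj; exists (g (level_of N y)).
have wv : w = v.
  apply: (table_cone (x := y) htb); first exact: in_cone_cat.
  by apply: prefix_of_cone (pad_prefix (le_N v)) _; rewrite vE -level_ofP.
have := congr1 (fun u : lvl => nth (digit0 n_gt1) u.2 (len (tb w))) vE.
by rewrite -wv /= !nth_mkseq //= !nth_default.
Qed.

(** Cutting long images down to level [N] is onto, hence injective. *)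
Lemma table_len_ge h tb : table h tb ->
  (forall w, N <= len (tb w)) -> injective (pad tb).
Proof.
move=> htb ge_N; have /choice[g gK] : forall u, exists w, pad tb w = u.
  move=> u; have [w wu] := table_cover (level_point n_gt1 u) htb; exists w.
  apply/eqP; rewrite -comparable_level.
  by apply: in_cone_comparable (prefix_of_cone (prefix_pad (ge_N w)) wu) (level_point_cone _ _).
have g_inj : injective g by apply: can_inj gK.
have [k kg gk] := injF_bij g_inj.
by move=> u v e; rewrite -(gk u) -(gk v) -(gK (k u)) -(gK (k v)) !gk e.
Qed.

(** If [tb w] differs from [w], exchanging their cones puts [w] in its place and
    moves no word that was in place. *)
Lemma table_perm h tb : table h tb -> (forall w, len (tb w) = N) -> tau_class h.
Proof.
have [m] := ubnP #|[pred w | tb w != level_word w]|.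
elim: m h tb => // m IHm h tb lt_m htb tbN.
have [fixed|/existsP[w w_moved]] := boolP [forall w, tb w == level_word w].
  left; rewrite -[RHS]ab_proj1; congr ab_proj; apply: act_inj => x; rewrite act1.
  have [hx _ _] := htb (level_of N x); rewrite (eqP (forallP fixed _)) in hx.
  by rewrite -[x in LHS](trunc_tail x N) hx trunc_tail.
have cd : small_swap S (tb w) (level_word w).
  split.
  - apply: contra w_moved => /comparable_eq; rewrite tbN len_level_word => /(_ erefl) ->.
    exact: eqxx.
  - move=> x xS; apply: contra w_moved => wx; have [ew ex] := table_fixed htb xS.
    by rewrite (table_cone htb wx ex) ew.
  - by move=> x xS; have [_ _ wS] := htb w; apply: contra w_moved => /(wS x xS) ->.
  - by rewrite tbN.
  - by rewrite len_level_word.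
have [|h' [htb' h'h]] := table_swap htb cd.
  move=> v; rewrite /swappable.
  have [_|nwv] := boolP (prefix_of (tb w) (tb v)); first by [].
  have [_|nwv'] := boolP (prefix_of (level_word w) (tb v)); first by [].
  apply/andP; split; rewrite comparable_sym.
    by apply: contra nwv => /comparable_le; apply; rewrite !tbN.
  by apply: contra nwv' => /comparable_le; apply; rewrite tbN len_level_word.
have swapN v : swapw (tb w) (level_word w) (tb v) = if v == w then level_word w else
    if tb v == level_word w then tb w else tb v.
  rewrite /swapw; have [->|neq] := eqVneq v w.
    by rewrite prefix_of_refl drop_oversize ?prefix_ext0 //.
  case: ifP => [wv|_].
    have e : w = v by apply: (table_code htb); rewrite /comparable wv.
    by rewrite e eqxx in neq.
  case: ifP => [wv|nwv].
    have e : level_word w = tb v by apply: prefix_of_eq wv _; rewrite tbN len_level_word.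
    by rewrite e eqxx drop_oversize ?prefix_ext0.
  by case: eqP => // e; rewrite e prefix_of_refl in nwv.
apply/h'h/(IHm _ _ _ htb') => [|v]; last first.
  by rewrite /= swapN; do 2?[case: ifP => _]; rewrite ?tbN ?len_level_word.
rewrite -ltnS; apply: leq_trans lt_m; rewrite ltnS; apply: proper_card.
apply/properP; split; last by exists w; rewrite !inE //= swapN eqxx eqxx.
apply/fintype.subsetP => v; rewrite !inE /= swapN.
have [->|neq] := eqVneq v w; first by rewrite eqxx.
by apply: contraNN => /eqP ->; rewrite (inj_eq (@level_word_inj _ _ _)) (negPf neq).
Qed.

(** Induction on the total excess length of the images over [N]. A longest image
    exceeds [N]; its siblings are images too, and some image [tb v] is shorter than
    [N]. Exchanging the cone of their parent with that of [tb v] lowers the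
    excess. *)
Lemma table_tau_class h tb : table h tb -> tau_class h.
Proof.
have [m] := ubnP (\sum_w (len (tb w) - N)); elim: m h tb => // m IHm h tb lt_m htb.
have [le_N|/forallPn[v0 v0N]] := boolP [forall w, len (tb w) <= N].
  by apply: (table_perm htb); apply: (table_len_le htb) => w; apply: (forallP le_N).
have [w0 _ w0_max] := @arg_maxnP _ v0 xpredT (fun w => len (tb w)) isT.
have w0N : N < len (tb w0) by apply: leq_trans (w0_max v0 isT); rewrite ltnNge.
(* [c] is the parent of a longest image. *)
have [c [j cE]] : exists c j, tb w0 = prefix_ext c [:: j].
  case E : (tb w0) => [e s]; case/lastP: s E => [|s j] E; first by rewrite E in w0N.
  by exists (e, s), j; rewrite /prefix_ext cats1.
have lenE : len (tb w0) = (len c).+1 by rewrite cE len_ext addn1.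
have cw0 : prefix_of c (tb w0) by rewrite cE prefix_of_ext.
have no_prefix w : prefix_of (tb w) c -> False.
  move=> wc; have e := table_code htb (_ : comparable (tb w) (tb w0)).
  have := prefix_of_len wc; rewrite e ?lenE ?ltnn // /comparable.
  by rewrite (prefix_of_trans wc cw0).
have sibling i : exists w, tb w = prefix_ext c [:: i].
  pose y := prefix_cat (prefix_ext c [:: i]) (fun=> digit0 n_gt1).
  have [w wy] := table_cover y htb; exists w.
  have yi : in_cone (prefix_ext c [:: i]) y by apply: in_cone_cat.
  have cy : in_cone c y by apply: prefix_of_cone yi; apply: prefix_of_ext.
  have [lt_w|ge_w] := ltnP (len c) (len (tb w)).
    apply: comparable_eq (in_cone_comparable wy yi) _.
    rewrite len_ext addn1; apply/eqP; rewrite eqn_leq lt_w andbT -lenE.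
    exact: w0_max.
  by case: (@no_prefix w); apply: comparable_le ge_w; apply: in_cone_comparable wy cy.
(* Otherwise two children of [c] would be cut to the same word of level [N]. *)
have [v vN] : exists v, len (tb v) < N.
  apply: contrapT => /forallNP ge_N.
  have {}ge_N w : N <= len (tb w) by rewrite leqNgt; apply/negP/ge_N.
  have [i ij] := other_digit n_gt1 j; have [w1 w1E] := sibling i.
  have e01 : pad tb w0 = pad tb w1.
    apply/eqP; rewrite -comparable_level.
    have cut w k : tb w = prefix_ext c [:: k] -> prefix_of (level_word (pad tb w)) c.
      move=> wE; apply: comparable_le; last by rewrite len_level_word; lia.
      have := prefix_pad (ge_N w); rewrite wE => /prefix_ofP[s E].
      by apply: (@comparable_ext _ _ _ _ s [:: k]); rewrite -E comparable_refl.
    have x_c := in_cone_cat c (fun=> digit0 n_gt1).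
    apply: (in_cone_comparable (prefix_of_cone (cut _ _ cE) x_c)).
    exact: prefix_of_cone (cut _ _ w1E) x_c.
  have e := table_len_ge htb ge_N e01; rewrite -e cE in w1E; move: w1E => [/eqP].
  by rewrite eqseq_cat // eqxx /= eqseq_cons eq_sym (negPf ij).
have le_Nc : N <= len c by rewrite -ltnS -lenE.
have nvc w : comparable c (tb w) -> prefix_of c (tb w) by case/orP => // /no_prefix.
have cd : small_swap S c (tb v).
  split.
  - apply/negP; rewrite comparable_sym => /comparable_le H; apply: (@no_prefix v); apply: H.
    by apply: leq_trans le_Nc; apply: ltnW.
  - move=> x xS; apply/negP => cx; have [ew ex] := table_fixed htb xS.
    apply: (@no_prefix (level_of N x)); apply: comparable_le.
      exact: in_cone_comparable ex cx.
    by rewrite ew len_level_word.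
  - move=> x xS; apply/negP => vx; have [ew ex] := table_fixed htb xS.
    by move: vN; rewrite (table_cone htb vx ex) ew len_level_word ltnn.
  - exact: leq_trans le_Nc.
  - by have [] := htb v.
have [|h' [htb' h'h]] := table_swap htb cd.
  move=> w; rewrite /swappable; have [//|ncw] := boolP (prefix_of c (tb w)).
  have [//|nvw] := boolP (prefix_of (tb v) (tb w)).
  apply/andP; split; first by rewrite comparable_sym; apply: contra ncw => /nvc.
  apply: contra nvw => /(table_code htb) ->; exact: prefix_of_refl.
apply/h'h/(IHm _ _ _ htb'); rewrite -ltnS; apply: leq_trans lt_m; rewrite ltnS.
have v_w0 : v != w0 by apply: contraTneq vN => ->; rewrite -leqNgt ltnW.
have v_new : swapw c (tb v) (tb v) = c.
  have ncv : ~~ prefix_of c (tb v) by apply/negP => /prefix_of_len; lia.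
  by rewrite /swapw (negPf ncv) prefix_of_refl drop_oversize ?prefix_ext0.
have w_new w : prefix_of c (tb w) -> len (swapw c (tb v) (tb w)) <= N.
  move=> cw; rewrite /swapw cw len_ext size_drop -/(len (tb w)).
  by have := w0_max w isT; rewrite lenE; lia.
rewrite (bigD1 w0) // (bigD1 v) //= [X in _ < X](bigD1 w0) // (bigD1 v) //= v_new.
have := w_new w0 cw0; rewrite lenE.
set new_sum := (X in _ + (_ + X) < _); set old_sum := (X in _ < _ + (_ + X)).
suff : new_sum <= old_sum by lia.
apply: leq_sum => w /andP[_ wv].
have [/w_new|ncw] := boolP (prefix_of c (tb w)); first by lia.
rewrite /swapw (negPf ncw) ifF //; apply/negP => vw.
by case/eqP: wv; apply/esym/(table_code htb); rewrite /comparable vw.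
Qed.

End Tables.

Lemma degree0_id h x : x \in S -> degree_rel (act h) x 0 ->
  exists l, forall k, l <= k -> repl (act h) (trunc x k) (trunc x k).
Proof.
move=> xS [a [b [ax hab e0]]]; exists (len a) => k ak.
have [c hc ec] := repl_trunc hab ax ak.
suff E : trunc x k = c by rewrite {2}E.
move: (repl_cone hc (in_cone_trunc x k)); rewrite act_fix // => cx.
by apply: in_cone_len_eq (in_cone_trunc x k) cx _; rewrite len_trunc; lia.
Qed.

(** The level of the table is chosen deep enough for the images to have length at
    least three and for the cones around the points of [S] to be fixed. *)
Lemma germ_trivial_tau_class h :
  (forall x, x \in S -> degree_rel (act h) x 0) -> tau_class h.
Proof.
move=> deg0; have [N0 hN0] := locally_repl_level n_gt1 (@act_locally_repl _ _ _ h).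
have /choice[l lP] : forall x, exists l, x \in S ->
    forall k, l <= k -> repl (act h) (trunc x k) (trunc x k).
  move=> x; have [xS|_] := boolP (x \in S); last by exists 0.
  by have [l] := degree0_id xS (deg0 x xS); exists l.
pose N := maxn (N0 + 3) (\max_(x <- (S : seq X)) l x).
have N03 : N0 + 3 <= N by apply: leq_maxl.
have /choice[tb tbP] : forall w : level n r N, exists b,
    repl (act h) (level_word w) b /\ 2 < len b.
  move=> w; pose x := level_point n_gt1 w.
  have [b hb] := hN0 (trunc x N0) (len_trunc x N0).
  have [|c hc ec] := @repl_trunc _ _ _ _ _ x N hb (in_cone_trunc _ _).
    by rewrite len_trunc; lia.
  exists c; split; last by move: ec; rewrite len_trunc; lia.
  by rewrite -[w](level_pointK n_gt1) level_word_of.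
have N_gt2 : 2 < N by lia.
apply: (@table_tau_class N N_gt2 h tb) => w; have [hw w3] := tbP w; split=> // x xS wx.
apply: (repl_uniq n_gt1 hw).
have wE : level_word w = trunc x N by rewrite -(eqP wx) len_level_word.
rewrite wE; apply: lP => //; rewrite /N leq_max; apply/orP; right.
exact: leq_bigmax_seq.
Qed.

(** For even [n], a small exchange is the product of the [n] small exchanges of
    corresponding subcones, all of the same class. *)
Lemma tau_even : ~~ odd n -> tau = 1%g.
Proof.
move=> n_even; have [nab Sa Sb a3 b3] := small0.
have nba : ~~ comparable b0 a0 by rewrite comparable_sym.
(* The exchange restricted to the subcones whose next digit is in [l]. *)
pose part (l : seq 'I_n) (x : X) : X :=
  if in_cone a0 x && (x.2 (len a0) \in l) then swapf a0 b0 x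
  else if in_cone b0 x && (x.2 (len b0) \in l) then swapf a0 b0 x else x.
have digit a psi : (prefix_cat a psi).2 (len a) = psi 0.
  by rewrite /= nth_default // subnn.
have part_a l psi : part l (prefix_cat a0 psi) =
    prefix_cat (if psi 0 \in l then b0 else a0) psi.
  rewrite /part in_cone_cat digit (negPf (in_cone_disjoint nab (in_cone_cat _ _))).
  by rewrite swapf_l /=; case: ifP.
have part_b l psi : part l (prefix_cat b0 psi) =
    prefix_cat (if psi 0 \in l then a0 else b0) psi.
  rewrite /part in_cone_cat digit (negPf (in_cone_disjoint nba (in_cone_cat _ _))).
  by rewrite swapf_r //=; case: ifP.
have part_out l x : ~~ in_cone a0 x -> ~~ in_cone b0 x -> part l x = x.
  by rewrite /part => /negPf-> /negPf->.
have cone_digit i a psi : in_cone (prefix_ext a [:: i]) (prefix_cat a psi) = (psi 0 == i).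
  rewrite in_cone_ext in_cone_cat tail_prefix_cat /in_cone /trunc /= /mkseq /=.
  by rewrite xpair_eqE eqxx /= eqseq_cons andbT.
have partP l : uniq l -> exists g, act g = part l /\ ab_proj g = (tau ^+ size l)%g.
  elim: l => [_|i l IHl /= /andP[il /IHl[g [gE g_tau]]]].
    exists 1%g; split; last by rewrite expg0.
    by rewrite act1; apply/funext => x; rewrite /part !andbF.
  pose ai := prefix_ext a0 [:: i]; pose bi := prefix_ext b0 [:: i].
  have nabi : ~~ comparable ai bi by apply: incomparable_ext.
  have small_i : small_swap S ai bi.
    split=> //; last 2 first.
    - by rewrite len_ext; lia.
    - by rewrite len_ext; lia.
    - exact: avoids_prefix (prefix_of_ext _ _) Sa.
    - exact: avoids_prefix (prefix_of_ext _ _) Sb.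
  have [_ Sai Sbi _ _] := small_i; have [s sE] := swap_build nabi Sai Sbi.
  exists (s * g)%g; split; last first.
    by rewrite ab_proj_mul g_tau (small_swap_eq n_gt1 r_gt0 small_i small0 sE tE) expgS.
  have swap_i c d psi : repl (swapf ai bi) (prefix_ext c [:: i]) (prefix_ext d [:: i]) ->
      psi 0 = i -> swapf ai bi (prefix_cat c psi) = prefix_cat d psi.
    move=> cd psi0; have psiE : psi = (prefix_cat (c.1, [:: i]) (fun k => psi k.+1)).2.
      by apply/funext => -[|k] //=; rewrite nth_nil subn1.
    by rewrite psiE -prefix_cat_ext cd prefix_cat_ext.
  have swap_a psi : swapf ai bi (prefix_cat a0 psi) =
      prefix_cat (if psi 0 == i then b0 else a0) psi.
    case: eqP => [|/eqP psi0]; first by apply: swap_i; apply: swapf_l.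
    rewrite swapf_out ?cone_digit //; apply: contra (in_cone_disjoint nab (in_cone_cat a0 psi)).
    exact/prefix_of_cone/prefix_of_ext.
  have swap_b psi : swapf ai bi (prefix_cat b0 psi) =
      prefix_cat (if psi 0 == i then a0 else b0) psi.
    case: eqP => [|/eqP psi0]; first by apply: swap_i; apply: swapf_r.
    rewrite swapf_out ?cone_digit //; apply: contra (in_cone_disjoint nba (in_cone_cat b0 psi)).
    exact/prefix_of_cone/prefix_of_ext.
  rewrite actM sE gE; apply/funext => x /=.
  have [/in_coneE ->|nax] := boolP (in_cone a0 x).
    rewrite !part_a inE; have [e|e] := eqVneq (tail x (len a0) 0) i.
      by rewrite e (negPf il) swap_a e eqxx.
    by case: ifP => _ /=; rewrite ?swap_a ?swap_b (negPf e).
  have [/in_coneE ->|nbx] := boolP (in_cone b0 x).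
    rewrite !part_b inE; have [e|e] := eqVneq (tail x (len b0) 0) i.
      by rewrite e (negPf il) swap_b e eqxx.
    by case: ifP => _ /=; rewrite ?swap_a ?swap_b (negPf e).
  rewrite !part_out // swapf_out //.
    exact: contra (prefix_of_cone (prefix_of_ext _ _)) nax.
  exact: contra (prefix_of_cone (prefix_of_ext _ _)) nbx.
have [g [gE]] := partP _ (enum_uniq 'I_n); rewrite size_enum_ord.
suff -> : g = t.
  have even_exp k : ~~ odd k -> (tau ^+ k = 1)%g.
    by move/even_halfK <-; rewrite -mul2n expgnA expg2 tau_sq expg1n.
  by rewrite even_exp.
apply: act_inj => x; rewrite gE tE.
have [/in_coneE ->|nax] := boolP (in_cone a0 x); first by rewrite part_a mem_enum swapf_l.
have [/in_coneE ->|nbx] := boolP (in_cone b0 x); first by rewrite part_b mem_enum swapf_r.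
by rewrite part_out // swapf_out.
Qed.

End Generation.

(** * Eventual periods and germs *)

Section Periods.
Variables n r : nat.
Local Notation X := (cantor n r).
Implicit Types x : X.

Definition eventual_period x p :=
  exists N, forall i, N <= i -> x.2 (i + p) = x.2 i.

(** The remainder of an eventual period modulo the least one is again an
    eventual period. *)
Lemma rational_period x : rational x ->
  exists p, [/\ 0 < p, eventual_period x p & forall q, eventual_period x q -> p %| q].
Proof.
move=> [N0 [p0 [p0_gt0 p0P]]].
have ex_p : exists p, `[< 0 < p /\ eventual_period x p >].
  by exists p0; apply/asboolP; split=> //; exists N0.
case: (ex_minnP ex_p) => p /asboolP[p_gt0 px] p_min; exists p; split=> // q [M qM].
have [N pN] := px; rewrite /dvdn; apply: contraT; rewrite -lt0n => mod_gt0.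
have shift k j : N <= j -> x.2 (j + k * p) = x.2 j.
  move=> Nj; elim: k => [|k IHk]; first by rewrite mul0n addn0.
  by rewrite mulSn addnCA addnC pN // (leq_trans Nj) ?leq_addr.
suff : p <= q %% p by rewrite leqNgt ltn_mod p_gt0.
apply: p_min; apply/asboolP; split=> //; exists (maxn M N) => i.
rewrite geq_max => /andP[Mi Ni].
rewrite -[RHS]qM // [in RHS](divn_eq q p) addnA addnAC shift //.
by rewrite (leq_trans Ni) ?leq_addr.
Qed.

End Periods.

Section Germs.
Variables n r : nat.
Hypothesis n_gt1 : 1 < n.
Local Notation X := (cantor n r).
Local Notation word := (prefix_word n r).
Local Notation repl := (@is_prefix_replacement n r).
Variable S : {fset X}.
Local Notation G := (stabilizer S).
Implicit Types (x y : X) (a b c d : word) (g h : G).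

Definition degree h x : int :=
  projT1 (cid (degree_rel_exists x (act_locally_repl h))).

Lemma degreeP h x : degree_rel (act h) x (degree h x).
Proof. exact: projT2 (cid (degree_rel_exists x (act_locally_repl h))). Qed.

Lemma degreeE h x k : degree_rel (act h) x k -> degree h x = k.
Proof. exact/(degree_rel_uniq n_gt1)/degreeP. Qed.

Lemma degreeM g h x : x \in S -> degree (g * h)%g x = (degree g x + degree h x)%R.
Proof.
move=> xS; apply: degreeE; rewrite actM.
have gx : degree_rel (act g) (act h x) (degree g x) by rewrite act_fix //; apply: degreeP.
exact: degree_relM (degreeP h x) gx.
Qed.

(** If [a] is replaced by [b] near a fixed point [x], then [x = a psi = b psi], so
    that the tail of [x] is shifted onto itself by the degree. *)
Lemma degree_period h x : x \in S -> eventual_period x `|degree h x|%N.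
Proof.
move=> xS; have [a [b [ax hab ->]]] := degreeP h x.
have bx : in_cone b x by rewrite -(act_fix h xS); apply: repl_cone hab ax.
have tails : tail x (len a) = tail x (len b).
  have := hab (tail x (len a)); rewrite -in_coneE // act_fix // {1}(in_coneE bx).
  by move/prefix_cat_inj.
wlog le_ab : a b {ax hab bx} tails / len a <= len b => [H|].
  have [/H|/ltnW/H] := leqP (len a) (len b); first exact.
  by rewrite distnC; apply.
exists (len a) => i ai; have := congr1 (@^~ (i - len a)) tails.
by rewrite /tail subnKC // => ->; congr (x.2 _); lia.
Qed.

Lemma swap_degree_out a b x : ~~ in_cone a x -> ~~ in_cone b x ->
  degree_rel (swapf a b) x 0.
Proof.
move=> nax nbx; pose c := trunc x (len a + len b); exists c, c; split.
- exact: in_cone_trunc.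
- by apply: swapf_fix; rewrite comparable_sym incomparable_trunc // ?leq_addr ?leq_addl.
- by rewrite GRing.subrr.
Qed.

Lemma isolating_prefix x : exists l, forall k y, y \in S -> y != x -> l <= k ->
  ~~ in_cone (trunc x k) y.
Proof.
have /choice[l lP] : forall y, exists l, y != x -> ~~ in_cone (trunc x l) y.
  move=> y; have [->|neq] := eqVneq y x; first by exists 0.
  apply: contrapT => /forallNP same; case/eqP: neq.
  have {}same l : in_cone (trunc x l) y.
    by apply: contrapT => /negP nl; apply: (same l).
  have trunc_eq l : trunc y l = trunc x l.
    by have /eqP := same l; rewrite len_trunc.
  case: x y trunc_eq {same} => [x1 x2] [y1 y2] trunc_eq.
  congr pair; first by have := congr1 fst (trunc_eq 0).
  apply/funext => i; have := congr1 snd (trunc_eq i.+1); rewrite /= !mkseqS.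
  by case/rcons_inj.
exists (\max_(y <- (S : seq X)) l y) => k y yS yx le_k; apply: contra (lP y yx).
apply/prefix_of_cone/trunc_prefix; apply: leq_trans le_k.
exact: (@leq_bigmax_seq _ _ xpredT l y).
Qed.

(** Push a small cone [a] around [x] onto the cone [a'] of a longer prefix of
    [x], through a cone [c] away from [S]; since the tail of [x] after [a] and
    after [a'] is the same, [x] is fixed. *)
Lemma degree_generator x p : 0 < p -> eventual_period x p -> x \in S ->
  exists h, degree h x = p%:Z%R /\
    forall y, y \in S -> y != x -> degree h y = 0%R.
Proof.
move=> p_gt0 [N pN] xS; have [l0 l0P] := isolating_prefix x.
pose l := maxn 1 (maxn N l0).
have [l_gt0 Nl l0l] : [/\ 0 < l, N <= l & l0 <= l] by split; rewrite /l; lia.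
pose a := trunc x l; pose a' := trunc x (l + p).
(* A cone whose word starts differently from [x] is disjoint from every cone
   around [x] other than the largest one. *)
have [j jx] := other_digit n_gt1 (x.2 0).
have [s cS] := avoids_ext n_gt1 S (x.1, [:: j]).
pose c := prefix_ext (x.1, [:: j]) s.
have aE k : 0 < k -> trunc x k = prefix_ext (x.1, [:: x.2 0]) (mkseq (tail x 1) k.-1).
  by case: k => // k _; rewrite -(add1n k) trunc_ext.
have nc k : 0 < k -> ~~ comparable c (trunc x k).
  move=> /aE ->; rewrite /c -[(x.1, [:: j])]/(prefix_ext (x.1, [::]) [:: j]).
  rewrite -[(x.1, [:: x.2 0])]/(prefix_ext (x.1, [::]) [:: x.2 0]) !prefix_ext_cat.
  exact: incomparable_siblings.
have nac : ~~ comparable a c by rewrite comparable_sym nc.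
have nca' : ~~ comparable c a' by apply: nc; lia.
have tails : tail x l = tail x (l + p).
  by apply/funext => i; rewrite /tail addnAC pN //; lia.
have a_x : x = prefix_cat a (tail x l) by rewrite trunc_tail.
have swap1 : swapf a c x = prefix_cat c (tail x l) by rewrite {1}a_x swapf_l.
have F_fix y : y \in S -> y != x -> swapf a c y = y /\ ~~ in_cone a' y.
  move=> yS yx; rewrite swapf_out ?cS //; last exact: (l0P l y).
  by split=> //; apply: (l0P (l + p) y) => //; lia.
pose F := swapf c a' \o swapf a c; pose F' := swapf a c \o swapf c a'.
have FK : cancel F F' by apply: can_comp; apply: swapfK.
have F'K : cancel F' F by apply: can_comp; apply: swapfK.
have [||y yS|h hE] := @stabilizer_build n r S F F' FK F'K.
- by apply: locally_repl_comp; apply: swapf_locally_repl.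
- by apply: locally_repl_comp; apply: swapf_locally_repl.
- have [->|yx] := eqVneq y x; first by rewrite /F /= swap1 swapf_l tails trunc_tail.
  by have [Fy ny] := F_fix y yS yx; rewrite /F /= Fy swapf_out ?cS.
exists h; split=> [|y yS yx]; apply: degreeE; rewrite hE.
  have -> : (p%:Z = (len a')%:Z - (len c)%:Z + ((len c)%:Z - (len a)%:Z))%R.
    by rewrite !len_trunc; lia.
  apply: (@degree_relM n r (swapf c a') (swapf a c)).
    by exists a, c; split=> //; [exact: in_cone_trunc | exact: swapf_l].
  by rewrite swap1; exists c, a'; split=> //; [exact: in_cone_cat | exact: swapf_l].
have [Fy ny] := F_fix y yS yx; rewrite -[0%R](GRing.addr0 0%R).
apply: (@degree_relM n r (swapf c a') (swapf a c)); last first.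
  by rewrite Fy; apply: swap_degree_out => //; apply: cS.
by apply: swap_degree_out; [exact: (l0P l y) | exact: cS].
Qed.

Lemma sign_act (n_odd : odd n) g h :
  sign n_gt1 (act (g * h)%g) = sign n_gt1 (act g) (+) sign n_gt1 (act h).
Proof.
rewrite actM.
apply: (signM n_gt1 n_odd (actK g) (actVK g) (actK h) (actVK h)); exact: act_locally_repl.
Qed.

End Germs.

(** * The sign of an exchange of siblings *)

Section SignSwap.
Variables n r : nat.
Hypotheses (n_gt1 : 1 < n).
Local Notation X := (cantor n r).
Local Notation word := (prefix_word n r).
Local Notation repl := (@is_prefix_replacement n r).

Local Notation i0 := (digit0 n_gt1).
Local Notation i1 := (digit1 n_gt1).

(** A point of the cone of [a] outside the first two subcones has a larger digit
    after [a] than both; a point outside the cone of [a] does not see that digit. *)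
Lemma lex_siblings (a : word) (x y z : X) :
    ~~ in_cone (prefix_ext a [:: i0]) x -> ~~ in_cone (prefix_ext a [:: i1]) x ->
    in_cone (prefix_ext a [:: i0]) y -> in_cone (prefix_ext a [:: i1]) z ->
  lex x y = lex x z.
Proof.
move=> nx0 nx1 /in_coneE -> /in_coneE ->; rewrite !prefix_cat_ext.
have [ax|nax] := boolP (in_cone a x); last first.
  have cx := in_cone_trunc x (len a).
  apply: (lex_cone _ cx (in_cone_cat _ _) cx (in_cone_cat _ _)).
  by rewrite comparable_sym incomparable_trunc.
pose i := tail x (len a) 0.
have i_big : 1 < i.
  move: nx0 nx1; rewrite !in_cone_ext ax /= /in_cone /trunc /= /mkseq /=.
  rewrite !xpair_eqE !eqxx /= !eqseq_cons !andbT -/i -!val_eqE /=.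
  by case: (i : nat) => [|[|]].
rewrite (in_coneE ax) !lex_prefix_cat /lex_tail.
have lexF (psi : nat -> 'I_n) : psi 0 < i ->
    `[< exists k, (forall j, j < k -> tail x (len a) j = psi j) /\
                  tail x (len a) k < psi k >] = false.
  move=> psi_i; apply/asboolP => -[[|k] [k_min]]; first by rewrite ltnNge (ltnW psi_i).
  by have := k_min 0 isT; move: psi_i; rewrite -/i => + e; rewrite -e ltnn.
by rewrite !lexF //; apply: leq_trans i_big.
Qed.

(** At the level of the two siblings, they form the only inverted pair. *)
Lemma sign_sibling_swap (n_odd : odd n) (a : word) :
  sign n_gt1 (swapf (prefix_ext a [:: i0]) (prefix_ext a [:: i1])) = true.
Proof.
set c := prefix_ext a [:: i0]; set d := prefix_ext a [:: i1]; pose N := (len a).+1.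
have ncd : ~~ comparable c d by apply: (@incomparable_siblings n r a i0 i1 [::] [::]).
have [cN dN] : len c = N /\ len d = N by rewrite !len_ext addn1.
have [u uE] := @level_wordP n r N c cN; have [v vE] := @level_wordP n r N d dN.
have FN : level_repl (swapf c d) N.
  move=> e eN; exists (swapw c d e); apply: swapw_repl => //; rewrite /swappable.
  have [//|nce] := boolP (prefix_of c e); have [//|nde] := boolP (prefix_of d e).
  by apply/andP; split; rewrite comparable_sym;
    [apply: contra nce | apply: contra nde] => /comparable_le; apply; rewrite ?cN ?dN eN.
rewrite -(signE n_gt1 n_odd (can_inj (swapfK ncd)) FN) /inversion_parity.
pose pt := @level_point n r n_gt1 N.
pose D w w' := inverts (swapf c d) (pt w) (pt w').
have F_inj := can_inj (swapfK ncd).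
have neq_uv : u != v by apply: contraNneq ncd => e; rewrite -uE -vE e comparable_refl.
have out (w : level n r N) : w != u -> w != v -> ~~ in_cone c (pt w) /\ ~~ in_cone d (pt w).
  by move=> wu wv; rewrite -uE -vE -!level_ofP level_pointK.
have [cu dv] : in_cone c (pt u) /\ in_cone d (pt v).
  by rewrite -uE -vE !level_point_cone.
have Fu : in_cone d (swapf c d (pt u)) by apply: repl_cone (swapf_l c d) cu.
have Fv : in_cone c (swapf c d (pt v)) by apply: repl_cone (swapf_r ncd) dv.
have D_out w w' : w != u -> w != v -> D w w' = false.
  move=> wu wv; have [nc nd] := out w wu wv; rewrite /D /inverts (swapf_out nc nd).
  have [->|w'u] := eqVneq w' u; first by rewrite (lex_siblings nc nd cu Fu) addbb.
  have [->|w'v] := eqVneq w' v; first by rewrite -(lex_siblings nc nd Fv dv) addbb.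
  by have [nc' nd'] := out w' w'u w'v; rewrite swapf_out // addbb.
have lt_cd x y : in_cone c x -> in_cone d y -> lex x y /\ ~~ lex y x.
  move=> cx dy; have lexE : lex x y.
    rewrite (in_coneE cx) (in_coneE dy) !prefix_cat_ext lex_prefix_cat.
    by apply/asboolP; exists 0.
  split=> //; rewrite lexN ?lexE // => e.
  by move: (in_cone_disjoint ncd cx); rewrite e dy.
have Duv : D u v = true.
  by rewrite /D /inverts; have [-> _] := lt_cd _ _ cu dv; have [_ /negPf ->] := lt_cd _ _ Fv Fu.
have D_sym w w' : D w w' = D w' w by apply: inverts_sym.
suff one_pair (p q : level n r N) : [set p; q] = [set u; v] -> D p q = true ->
    enum_rank p < enum_rank q ->
    odd (\sum_(z : level n r N * level n r N | enum_rank z.1 < enum_rank z.2)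
           D z.1 z.2).
  have [lt_uv|lt_vu|/val_inj/enum_rank_inj e] := ltngtP (enum_rank u) (enum_rank v).
  - exact: (one_pair u v).
  - apply: (one_pair v u) _ _ lt_vu; first exact: finset.setUC.
    by rewrite -[LHS]D_sym.
  - by rewrite e eqxx in neq_uv.
move=> pq Dpq lt_pq; rewrite (bigD1 (p, q)) //= Dpq big1 // => -[w w'] /=.
have mem w0 : w0 \notin [set p; q] -> (w0 != u) && (w0 != v).
  by rewrite pq !inE negb_or.
case/andP=> lt_w neq_w; apply/eqP; rewrite eqb0; apply/negP => Dw.
have w_in : w \in [set p; q].
  by apply: contraTT Dw => /mem/andP[wu wv]; rewrite D_out.
have w'_in : w' \in [set p; q].
  by apply: contraTT Dw => /mem/andP[wu wv]; rewrite D_sym D_out.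
move: w_in w'_in lt_w neq_w; rewrite !inE => /orP[]/eqP-> /orP[]/eqP->;
  rewrite ?ltnn ?eqxx //.
by rewrite ltnNge ltnW.
Qed.

End SignSwap.

(** * The isomorphism *)

Section Abelianization.
Variables n r : nat.
Hypotheses (n_gt1 : 1 < n) (r_gt0 : 0 < r).
Local Notation X := (cantor n r).
Variable S : {fset X}.
Hypothesis S_rational : forall x, x \in S -> rational x.
Local Notation G := (stabilizer S).
Implicit Types (x y : X) (g h : G).
Import GRing.Theory.
Local Open Scope ring_scope.

Lemma period_exists : exists per : X -> nat, forall x, x \in S ->
  [/\ (0 < per x)%N, eventual_period x (per x) &
      forall q, eventual_period x q -> (per x %| q)%N].
Proof.
have /choice[per perP] : forall x, exists p, x \in S ->
    [/\ (0 < p)%N, eventual_period x p & forall q, eventual_period x q -> (p %| q)%N].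
  move=> x; have [xS|_] := boolP (x \in S); last by exists 0%N.
  by have [p pP] := rational_period (S_rational xS); exists p.
by exists per.
Qed.

Definition period : X -> nat := projT1 (cid period_exists).

Lemma periodP x : x \in S -> [/\ (0 < period x)%N, eventual_period x (period x) &
  forall q, eventual_period x q -> (period x %| q)%N].
Proof. exact: projT2 (cid period_exists) x. Qed.

Definition germ h x : int := (degree h x %/ (period x)%:Z)%Z.

Lemma germK h x : x \in S -> germ h x * (period x)%:Z = degree h x.
Proof.
move=> xS; apply: divzK; have [_ _ per_dvd] := periodP xS.
exact/per_dvd/degree_period.
Qed.

Lemma germM g h x : x \in S -> germ (g * h)%g x = germ g x + germ h x.
Proof.
move=> xS; have [p_gt0 _ _] := periodP xS.
have p_neq0 : (period x)%:Z != 0 by rewrite eqz_nat -lt0n.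
by apply: (mulIf p_neq0); rewrite mulrDl !germK // degreeM.
Qed.

Definition fixed_point (i : 'I_#|` S|) : X := tnth (in_tuple S) i.

Lemma fixed_pointP i : fixed_point i \in S.
Proof. exact: mem_tnth. Qed.

Lemma fixed_point_inj : injective fixed_point.
Proof. by apply/tuple_uniqP; apply: fset_uniq. Qed.

Definition germs h : 'rV[int]_#|` S| := \row_i germ h (fixed_point i).

Lemma germsM g h : germs (g * h)%g = germs g + germs h.
Proof. by apply/rowP => i; rewrite !mxE germM ?fixed_pointP. Qed.

Lemma germs_surj (v : 'rV[int]_#|` S|) : exists h, germs h = v.
Proof.
pose im v := exists h, germs h = v.
have germs1 : germs 1%g = 0.
  by apply: (addrI (germs 1%g)); rewrite -germsM mulg1 addr0.
have imD u w : im u -> im w -> im (u + w).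
  by move=> [g <-] [h <-]; exists (g * h)%g; apply: germsM.
have imN u : im u -> im (- u).
  move=> [g <-]; exists g^-1%g; apply: (addrI (germs g)).
  by rewrite -germsM mulgV germs1 subrr.
have im_nat u m : im u -> im (u *+ m).
  by move=> u_im; elim: m => [|m IHm]; [exists 1%g | rewrite mulrS; apply: imD].
have im_delta i : im (delta_mx 0 i).
  have [p_gt0 px p_dvd] := periodP (fixed_pointP i).
  have [h [hx hy]] := degree_generator n_gt1 p_gt0 px (fixed_pointP i).
  exists h; apply/rowP => j; rewrite !mxE /= /germ.
  have [->|ji] := eqVneq j i; first by rewrite hx divzz eqz_nat -lt0n p_gt0.
  by rewrite hy ?fixed_pointP ?div0z // (inj_eq fixed_point_inj).
rewrite [v]row_sum_delta; elim/big_ind: _ => [|u w|i _]; first by exists 1%g.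
  exact: imD.
have scaleE m : m%:Z *: delta_mx 0 i = delta_mx 0 i *+ m :> 'rV[int]_#|` S|.
  by rewrite -natz scaler_nat.
by case: (v 0 i) => m; rewrite ?NegzE ?scaleNr scaleE; do ?apply: imN; apply: im_nat.
Qed.

Lemma germs_trivial h : germs h = 0 -> forall x, x \in S -> degree_rel (act h) x 0.
Proof.
move=> h0 x xS; suff <- : degree h x = 0 by apply: degreeP.
have xi : (index x (S : seq X) < #|` S|)%N by rewrite index_mem.
have := congr1 (fun v : 'rV_#|` S| => v 0 (Ordinal xi)) h0; rewrite !mxE -germK //.
by rewrite /fixed_point (tnth_nth x) /= nth_index // => ->; rewrite mul0r.
Qed.

Lemma germs_swap (t : G) (a b : prefix_word n r) :
  small_swap S a b -> act t = swapf a b -> germs t = 0.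
Proof.
move=> [_ Sa Sb _ _] tE; apply/rowP => i; rewrite !mxE /germ.
rewrite (@degreeE _ _ n_gt1 _ _ _ 0) ?div0z // tE.
by apply: swap_degree_out; [apply: Sa | apply: Sb]; apply: fixed_pointP.
Qed.

Lemma abelianization_even : ~~ odd n ->
  isomorphic_groups (abelianization G) (Algebra.to_multiplicative 'rV[int]_#|` S|).
Proof.
move=> n_even; apply: (abelianization_isomorphic germsM germs_surj) => h h0.
have [t [a [small tE]]] := sibling_swap_exists n_gt1 S r_gt0.
have tau1 := tau_even n_gt1 r_gt0 small tE n_even.
by case: (germ_trivial_tau_class n_gt1 r_gt0 small tE (germs_trivial h0)) => ->.
Qed.

Lemma abelianization_odd : odd n ->
  isomorphic_groups (abelianization G)
    (Algebra.to_multiplicative ('rV[int]_#|` S| * 'Z_2)%type).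
Proof.
move=> n_odd; have [t [a [small tE]]] := sibling_swap_exists n_gt1 S r_gt0.
pose sgn h : 'Z_2 := (sign n_gt1 (act h) : nat)%:R.
have sgnM g h : sgn (g * h)%g = sgn g + sgn h.
  by rewrite /sgn sign_act //; case: sign; case: sign; apply/val_inj.
have sgn_t : sgn t = 1 by rewrite /sgn tE sign_sibling_swap.
have germs_t := germs_swap small tE.
apply: (@abelianization_isomorphic _ _ (fun h => (germs h, sgn h))).
- by move=> g h; rewrite germsM sgnM.
- move=> [v z]; have [h hv] := germs_surj v.
  have [hz|hz] := eqVneq (sgn h) z; first by exists h; rewrite hv hz.
  (* [t] changes the sign and keeps the germs. *)
  exists (t * h)%g; rewrite germsM sgnM germs_t add0r hv sgn_t; congr pair.
  by move: (sgn h) z hz => [[|[|//]] ?] [[|[|//]] ?] // _; apply/val_inj.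
- move=> h [h0 sgn0].
  case: (germ_trivial_tau_class n_gt1 r_gt0 small tE (germs_trivial h0)) => // h_tau.
  by have := additive_ab_proj sgnM h_tau; rewrite sgn0 sgn_t.
Qed.

End Abelianization.

Theorem theorem11 (n r : nat) (S : {fset cantor n r}) :
  (2 <= n)%N -> (1 <= r)%N ->
  (forall x : cantor n r, x \in S -> rational x) ->
  (~~ odd n ->
     isomorphic_groups (abelianization (Fix (fun x : cantor n r => x \in S)))
       (Algebra.to_multiplicative 'rV[int]_(#|` S|))) /\
  (odd n ->
     isomorphic_groups (abelianization (Fix (fun x : cantor n r => x \in S)))
       (Algebra.to_multiplicative ('rV[int]_(#|` S|) * 'Z_2)%type)).
Proof.
move=> n_gt1 r_gt0 S_rational; split.
  exact: (abelianization_even n_gt1 r_gt0 S_rational).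
exact: (abelianization_odd n_gt1 r_gt0 S_rational).
Qed.
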